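(* Let $X$ be a complex Banach space, $R>0$, $k\in\mathbb{Z}$ and $m\in\mathbb{N}_0$. A mode $k$ function $\hat f_k:B_R(\mathbf 0)\times\mathbb{R}\to X$ belongs to $C^m(B_R(\mathbf 0)\times\mathbb{R};X)$ if and only if its radial coefficient $f_k$ belongs to $$C^m_{(k)}([0,R)\times\mathbb{R};X):=\big\{f_k:[0,R)\times\mathbb{R}\to X\ \big|\ \mathcal{D}_{-k+i}^{\,n-i}\mathcal{D}_k^{\,i}\partial_z^{p-n}f_k\in C^0_{(k+n-2i)}([0,R)\times\mathbb{R};X),\ 0\le i\le n\le p\le m\big\}.$$
   Context: $B_R(\mathbf 0)$ is the open ball of radius $R$ in $\mathbb{R}^2$. A mode $k$ function is a function with $\hat f_k(r\cos\theta,r\sin\theta,z)=\mathrm{e}^{\mathrm{i}k\theta}f_k(r,z)$ for $r\in[0,R)$, $\theta\in\mathbb{T}^1$, $z\in\mathbb{R}$, where $f_k:[0,R)\times\mathbb{R}\to X$ (the radial coefficient) satisfies $f_k(0,z)=0$ if $k\ne0$. For $j\in\mathbb{Z}$, $\mathcal{D}_j:=\frac{\partial}{\partial r}+\frac jr$ and $\mathcal{D}_j^n:=\mathcal{D}_{j-(n-1)}\cdots\mathcal{D}_{j-1}\mathcal{D}_j$. For $j\in\mathbb{Z}$, $$C^0_{(j)}([0,R)\times\mathbb{R};X):=\{f\in C^0([0,R)\times\mathbb{R};X)\mid j\,f|_{r=0}=0\}.$$ The membership of $\mathcal{D}_{-k+i}^{\,n-i}\mathcal{D}_k^{\,i}\partial_z^{p-n}f_k$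 in $C^0_{(k+n-2i)}$ means that this derivative exists and is continuous for $r\in(0,R)$ (so that $f_k$ is $m$ times continuously differentiable on $(0,R)\times\mathbb{R}$) and extends continuously to $r=0$, the extension lying in $C^0_{(k+n-2i)}$. *)

(* Defs.v *)
From HB Require Import structures.
From mathcomp Require Import all_boot all_order all_algebra.
From mathcomp Require Import complex.
From mathcomp Require Import all_classical all_reals all_analysis.

Set Implicit Arguments.
Unset Strict Implicit.
Unset Printing Implicit Defensive.

Import Order.TTheory GRing.Theory Num.Theory.
Import numFieldNormedType.Exports.

Local Open Scope classical_set_scope.
Local Open Scope complex_scope.
Local Open Scope ring_scope.

(* Restriction of scalars from R[i] to R: same group and same uniform
   structure (hence the same topology) as X, real scalars acting through
   a |-> a%:C, and the (real-valued) norm of X. It makes the library's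
   derivatives with respect to real variables available for X-valued maps. *)
Definition realified (R : realType) (X : normedModType R[i]) : Type := X.

Section Realified.
Variables (R : realType) (X : normedModType R[i]).
Local Notation XR := (realified X).

HB.instance Definition _ := GRing.Zmodule.copy XR X.
HB.instance Definition _ := Uniform.copy XR X.
HB.instance Definition _ := Pointed.copy XR X.

Definition realified_scale (a : R) (x : XR) : XR := a%:C *: (x : X).

Lemma realified_scaleA a b x :
  realified_scale a (realified_scale b x) = realified_scale (a * b) x.
Proof. by rewrite /realified_scale rmorphM scalerA. Qed.

Lemma realified_scale1 : left_id 1 realified_scale.
Proof. by move=> x; rewrite /realified_scale rmorph1 scale1r. Qed.

Lemma realified_scaleDr : right_distributive realified_scale +%R.
Proof. by move=> a x y; rewrite /realified_scale scalerDr. Qed.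

Lemma realified_scaleDl x : {morph realified_scale^~ x : a b / a + b}.
Proof. by move=> a b; rewrite /realified_scale rmorphD scalerDl. Qed.

HB.instance Definition _ := GRing.Zmodule_isLmodule.Build R XR
  realified_scaleA realified_scale1 realified_scaleDr realified_scaleDl.

Definition realified_norm (x : XR) : R := complex.Re `|(x : X)|.

Lemma realified_normE (x : XR) : (realified_norm x)%:C = `|(x : X)|.
Proof.
rewrite /realified_norm; have := normr_ge0 (x : X).
by case: `|(x : X)| => a b; rewrite lecE /= => /andP[/eqP -> _].
Qed.

Lemma realified_normD x y :
  realified_norm (x + y) <= realified_norm x + realified_norm y.
Proof. by rewrite -lecR rmorphD /= !realified_normE ler_normD. Qed.

Lemma realified_norm0_eq0 x : realified_norm x = 0 -> x = 0.
Proof.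
by move=> x0; apply/(@normr0_eq0 _ X); rewrite -realified_normE x0.
Qed.

Lemma realified_normMn x n : realified_norm (x *+ n) = realified_norm x *+ n.
Proof.
by apply: complexI; rewrite rmorphMn /= !realified_normE -normrMn.
Qed.

Lemma realified_normN x : realified_norm (- x) = realified_norm x.
Proof. by apply: complexI; rewrite !realified_normE normrN. Qed.

HB.instance Definition _ := Num.Zmodule_isNormed.Build R XR
  realified_normD realified_norm0_eq0 realified_normMn realified_normN.

Definition realified_ball (x : XR) (e : R) (y : XR) : Prop :=
  ball (x : X) e%:C (y : X).

Lemma realified_ball_center x e : 0 < e -> realified_ball x e x.
Proof. by move=> e0; apply: ballxx; rewrite ltcR. Qed.

Lemma realified_ball_sym x y e : realified_ball x e y -> realified_ball y e x.
Proof. exact: ball_sym. Qed.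

Lemma realified_ball_triangle x y z e1 e2 :
  realified_ball x e1 y -> realified_ball y e2 z ->
  realified_ball x (e1 + e2) z.
Proof. by rewrite /realified_ball rmorphD; exact: ball_triangle. Qed.

Lemma realified_entourageE : entourage = entourage_ realified_ball.
Proof.
rewrite -[LHS](@entourage_ballE R[i] X); apply/seteqP; split => A [e e0 eA].
- have eE : e = (complex.Re e)%:C.
    by case: e e0 {eA} => a b /=; rewrite ltcE /= => /andP[/eqP -> _].
  exists (complex.Re e); first by move: e0; rewrite /= {1}eE ltcR.
  by move=> xy; rewrite /= /realified_ball -eE; exact: eA.
- by exists e%:C => //=; rewrite ltcR.
Qed.

HB.instance Definition _ := Uniform_isPseudoMetric.Build R XR
  realified_ball_center realified_ball_sym realified_ball_triangle
  realified_entourageE.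

Lemma realified_ball_normE :
  @ball R XR = ball_ (fun x : XR => `|x|).
Proof.
apply/funext => x; apply/funext => e; apply/funext => y.
rewrite /ball /= /realified_ball -(@ball_normE _ X) /ball_ /=.
by apply/propext; rewrite -(@realified_normE (x - y)) ltcR.
Qed.

HB.instance Definition _ :=
  NormedZmod_PseudoMetric_eq.Build R XR realified_ball_normE.

Lemma realified_normZ (a : R) (x : XR) : `|a *: x| = `|a| * `|x|.
Proof.
apply: complexI; rewrite rmorphM /= !realified_normE.
by rewrite [LHS]normrZ normc_def /= expr0n addr0 sqrtr_sqr.
Qed.

HB.instance Definition _ :=
  PseudoMetricNormedZmod_Lmodule_isNormedModule.Build R XR realified_normZ.

End Realified.

HB.instance Definition _ (R : realType) (X : completeNormedModType R[i]) :=
  Uniform_isComplete.Build (realified X) (@cauchy_cvg X).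

(* C^m(U; W) for U open in R^3: all partial derivatives of order at most m
   exist and are continuous on U. *)
Fixpoint is_Cm (R : realType) (W : normedModType R) (m : nat)
    (U : set (R * R * R)) (f : R * R * R -> W) : Prop :=
  (forall p, U p -> {for p, continuous f}) /\
  (if m is m'.+1 then
     forall e : R * R * R,
       [\/ e = (1, 0, 0), e = (0, 1, 0) | e = (0, 0, 1)] ->
       (forall p, U p -> derivable f p e) /\ is_Cm m' U ('D_e f)
   else True).

(* The Euclidean disc times the line; the library's ball on R * R is a square. *)
Definition cylinder (R : realType) (rho : R) : set (R * R * R) :=
  [set p | p.1.1 ^+ 2 + p.1.2 ^+ 2 < rho ^+ 2].

Definition half_strip (R : realType) (rho : R) : set (R * R) :=
  [set p | 0 <= p.1 < rho].

Definition open_half_strip (R : realType) (rho : R) : set (R * R) :=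
  [set p | 0 < p.1 < rho].

Definition cis (R : realType) (t : R) : R[i] := cos t +i* sin t.

(* Functions on the cylinder and on the half strip are represented by total
   functions whose values elsewhere are irrelevant. *)
Definition is_mode (R : realType) (X : normedModType R[i]) (rho : R) (k : int)
    (fhat : R * R * R -> X) (f : R * R -> X) : Prop :=
  (forall r t z : R, 0 <= r < rho ->
     fhat (r * cos t, r * sin t, z) = cis (k%:~R * t) *: f (r, z)) /\
  (k != 0 -> forall z : R, f (0, z) = 0).

Section RadialSpaces.
Variables (R : realType) (W : normedModType R) (rho : R).
Implicit Types (f g h : R * R -> W) (j k : int).

Definition partial_r f : R * R -> W := 'D_((1, 0) : R * R) f.
Definition partial_z f : R * R -> W := 'D_((0, 1) : R * R) f.

Definition radD j f : R * R -> W :=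
  fun p => partial_r f p + (j%:~R / p.1) *: f p.

(* radD_iter n j = radD (j - (n - 1)) \o ... \o radD (j - 1) \o radD j *)
Fixpoint radD_iter (n : nat) j f : R * R -> W :=
  if n is n'.+1 then radD (j - n'%:Z) (radD_iter n' j f) else f.

Definition has_partial_z_iter (n : nat) f : Prop :=
  forall l, (l < n)%N -> forall p, open_half_strip rho p ->
    derivable (iter l partial_z f) p (0, 1).

Definition has_radD_iter (n : nat) j f : Prop :=
  forall l, (l < n)%N -> forall p, open_half_strip rho p ->
    derivable (radD_iter l j f) p (1, 0).

Definition C0_rad j f : Prop :=
  {within half_strip rho, continuous f} /\
  (forall z : R, j%:~R *: f (0, z) = 0).

Definition extends_C0_rad j h : Prop :=
  exists2 g, C0_rad j g & forall p, open_half_strip rho p -> g p = h p.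

(* The case p = 0 of the family is f itself, which is defined also at r = 0:
   there the condition is on f and not merely on an extension of its
   restriction to r > 0, whence the first conjunct. *)
Definition Cm_rad (m : nat) k f : Prop :=
  C0_rad k f /\
  forall i n p : nat, (i <= n)%N -> (n <= p)%N -> (p <= m)%N ->
    let fz := iter (p - n) partial_z f in
    let fi := radD_iter i k fz in
    [/\ has_partial_z_iter (p - n) f,
        has_radD_iter i k fz,
        has_radD_iter (n - i) (- k + i%:Z) fi
      & extends_C0_rad (k + n%:Z - (2 * i)%N%:Z)
          (radD_iter (n - i) (- k + i%:Z) fi)].

End RadialSpaces.

(* Main.v *)
(* On a function e^(ikt) f(r, z) the operators D_x - i D_y and D_x + i D_y act as
   D_k and D_{-k} on the radial coefficient and lower, resp. raise, the mode by
   one. Hence fhat is C^(m+1) iff its image under these two operators and under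
   D_z are C^m, and the theorem follows by induction on m once C^(m+1)_(k) is
   known to be stable in the same sense. For the latter one needs
   D_{k+1} D_{-k} = D_{-k+1} D_k (both are the Laplacian on mode k) and the
   commutation of D_z with D_j, which is Schwarz's theorem in the form that
   assumes only one of the mixed derivatives. On the axis r = 0, where a
   derivative of fhat is only known to extend continuously, the mean value
   inequality on nearby parallel segments shows that the extension is the
   derivative. *)

From HB Require Import structures.
Require Import Defs.
From mathcomp Require Import all_boot all_order all_algebra.
From mathcomp Require Import complex.
From mathcomp Require Import all_classical all_reals all_analysis.
From mathcomp Require Import ring lra zify.

Set Implicit Arguments.
Unset Strict Implicit.
Unset Printing Implicit Defensive.

Import Order.TTheory GRing.Theory Num.Theory.
Import numFieldNormedType.Exports.

Local Open Scope classical_set_scope.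
Local Open Scope ring_scope.

(** * Derivatives along a direction *)

Section Calculus.
Variables (R : realType) (W : normedModType R).

(** Every entry of the family in [Cm_rad] applies D_z first, then D_k, then D_{-k+i}. Replacing f by
    D_k f or D_{-k} f puts a new operator innermost, so each entry for the image has to be reordered
    into an entry for f, and only the latter is known to exist. This is why D_z D_j f may not be
    assumed to exist, and why D_{-k} must also be moved past D_k^i. The implication from C^m to
    C^m_(k) needs no reordering: there the innermost operator is peeled off. Schwarz's theorem and
    the passage to the axis are one argument: if [Phi s] tends pointwise to F as s decreases to 0
    and the derivatives of [Phi s] along v are uniformly close to A near p, then A is the derivative
    of F at p. The first case takes difference quotients for [Phi s], the second translates of F. *)

Lemma is_derive_epsP (V : normedModType R) (f : V -> W) p v A :
  is_derive p v f A <->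
  forall e, 0 < e -> exists2 d, 0 < d &
    forall h, `|h| < d -> `|f (p + h *: v) - f p - h *: A| <= e * `|h|.
Proof.
split=> [[dfp Dfp] e e0|H].
- have : (fun h => h^-1 *: ((f \o shift p) (h *: v) - f p)) @ 0^' --> A.
    by rewrite -Dfp; exact: dfp.
  move=> /cvgrPdist_le /(_ _ e0) [d /= d0 Hd].
  exists d => // h hd.
  have [->|h0] := eqVneq h 0.
    by rewrite !scale0r addr0 subrr subr0 !normr0 mulr0.
  have := Hd h; rewrite /= sub0r normrN => /(_ hd h0).
  rewrite -(ler_pM2r (x := `|h|)) ?normr_gt0 //.
  by rewrite mulrC -normrZ scalerBr scalerA divff // scale1r (addrC p) distrC.
- have C : (fun h => h^-1 *: ((f \o shift p) (h *: v) - f p)) @ 0^' --> A.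
    apply/cvgrPdist_le => e e0; have [d d0 Hd] := H e e0.
    exists d => // h /=; rewrite sub0r normrN => hd h0.
    have := Hd h hd; rewrite -(ler_pM2r (x := `|h|^-1)) ?invr_gt0 ?normr_gt0 //.
    rewrite mulfK ?normr_eq0 // mulrC -normfV -normrZ scalerBr scalerA.
    by rewrite mulVf // scale1r distrC (addrC p).
  by split; [apply/cvg_ex; exists A | apply: cvg_lim].
Qed.

(** Derivability along one direction gives neither continuity nor differentiability in several
    variables. On a line it gives both, so product and chain rules are proved there and carried
    back. *)
Lemma is_derive_line (V : normedModType R) (f : V -> W) p v t A :
  is_derive (p + t *: v) v f A <->
  is_derive t (1 : R) (fun s => f (p + s *: v)) A.
Proof.
split=> /is_derive_epsP H; apply/is_derive_epsP => e /H[d d0 Hd];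
  exists d => // h /Hd; by rewrite -[h%:A]/(h * 1) mulr1 scalerDl addrA.
Qed.

Lemma is_derive_line0 (V : normedModType R) (f : V -> W) p v A :
  is_derive p v f A <->
  is_derive (0 : R) (1 : R) (fun s => f (p + s *: v)) A.
Proof. by rewrite -is_derive_line scale0r addr0. Qed.

Lemma is_derive_cts (f : R -> W) (t : R) A : is_derive t (1 : R) f A -> {for t, continuous f}.
Proof. by move=> [/derivable1_diffP/differentiable_continuous]. Qed.

(* The least upper bound [c] of the points where [`|g t - g 0| <= M' * t],
   [M' > M], is such a point, and so is every point slightly beyond [c < 1]. *)
Lemma mean_value_ineq (g dg : R -> W) (M : R) :
  (forall t : R, 0 <= t <= 1 -> is_derive t (1 : R) g (dg t) /\ `|dg t| <= M) ->
  `|g 1 - g 0| <= M.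
Proof.
move=> H; apply/ler_addgt0Pr => e e0.
set phi := fun t : R => `|g t - g 0| - (M + e) * t.
rewrite -subr_le0 -[X in _ - X]mulr1 -/(phi 1) leNgt; apply/negP => phi1.
set S := [set t : R | 0 <= t <= 1 /\ phi t <= 0].
have S0 : S 0 by rewrite /S /= lexx ler01 /phi subrr normr0 mulr0 subrr.
have hS : has_sup S by split; [exists 0 | exists 1 => t [/andP[]]].
set c := sup S.
have c01 : 0 <= c <= 1.
  apply/andP; split; first exact: ub_le_sup hS.2 _ S0.
  by apply: ge_sup; [exists 0 | move=> t [/andP[]]].
have [dc Mc] := H c c01.
have phi_cts : {for c, continuous phi}.
  have gc := is_derive_cts dc.
  apply: cvgB; last by apply: cvgM; [exact: cvg_cst | exact: cvg_id].
  by apply: cvg_norm; apply: cvgB => //; exact: cvg_cst.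
have phic : phi c <= 0.
  rewrite leNgt; apply/negP => phic.
  have [d /= d0 Hd] := cvgr_gt _ phi_cts _ phic.
  have [t St ct] := sup_adherent d0 hS.
  have tc : t <= c := ub_le_sup hS.2 St.
  have := Hd t; rewrite /ball_ /= ger0_norm ?subr_ge0 // => /(_ _).
  rewrite -/c in ct; move=> H'; have : 0 < phi t by apply: H'; lra.
  by rewrite ltNge (proj2 St).
have c1 : c < 1.
  have /andP[_] := c01; rewrite le_eqVlt => /predU1P[c1|//].
  by move: phic; rewrite c1 leNgt phi1.
(* The slack [e] in the slope M + e absorbs the remainder of the first-order expansion at [c]. *)
have [d d0 Hd] := (is_derive_epsP g c 1 (dg c)).1 dc _ e0.
pose h := Num.min (d / 2) (1 - c).
have h0 : 0 < h by rewrite lt_min divr_gt0 //= subr_gt0.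
have hd : h < d by rewrite gt_min; apply/orP; left; lra.
have hc : h <= 1 - c by rewrite ge_min lexx orbT.
suff : S (c + h) by move/(ub_le_sup hS.2); rewrite -/c; lra.
split; first by move/andP: c01 => []; lra.
have := Hd h; rewrite gtr0_norm // => /(_ hd).
rewrite -[h%:A]/(h * 1) mulr1 => He.
have : `|g (c + h) - g 0| <= e * h + h * M + `|g c - g 0|.
  rewrite [X in `|X|](_ : _ =
    (g (c + h) - g c - h *: dg c) + h *: dg c + (g c - g 0)); last first.
    by rewrite subrK addrA subrK.
  apply: (le_trans (ler_normD _ _)); rewrite lerD2r.
  apply: (le_trans (ler_normD _ _)); apply: lerD => //.
  by rewrite normrZ gtr0_norm // ler_pM2l.
by move: phic; rewrite /phi; lra.
Qed.

(** In one real variable derivable and differentiable agree, so the chain rule for differentials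
    applies. *)
Lemma is_derive1_comp (f : R -> W) (a : R -> R) (t a' : R) A :
  is_derive t (1 : R) a a' -> is_derive (a t) (1 : R) f A ->
  is_derive t (1 : R) (f \o a) (a' *: A).
Proof.
move=> [/derivable1_diffP da Da] [/derivable1_diffP df Df].
have dfa : differentiable (f \o a) t by exact: differentiable_comp.
split; first exact/derivable1_diffP.
rewrite (deriveE _ dfa) diff_comp //= -(deriveE _ da) Da.
by rewrite -[a' in LHS]mulr1 -[a' * 1]/(a' *: 1) linearZ /= -(deriveE _ df) Df.
Qed.

Lemma is_derive1_scale (a : R -> R) (f : R -> W) (t a' : R) A :
  is_derive t (1 : R) a a' -> is_derive t (1 : R) f A ->
  is_derive t (1 : R) (fun s => a s *: f s) (a' *: f t + a t *: A).
Proof.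
move=> da df; have ac : {for t, continuous a}.
  by case: da => /derivable1_diffP/differentiable_continuous.
have [[da_ Da] [df_ Df]] := (da, df).
have C : (fun h : R => h^-1 *: (((fun s => a s *: f s) \o shift t) (h *: 1) - a t *: f t))
    @ 0^' --> a' *: f t + a t *: A.
  (* Leibniz splitting: the increment of [a] multiplies [f t], the increment of [f] multiplies the
     shifted value of [a]. *)
  rewrite (_ : (fun h : R => _) = (fun h : R =>
     (h^-1 *: ((a \o shift t) (h *: 1) - a t)) *: f t +
     (a \o shift t) (h *: 1) *: (h^-1 *: ((f \o shift t) (h *: 1) - f t)))); last first.
    apply/funext => h /=; rewrite scalerA mulrC -[_ *: (_ - _) in RHS]/(_ * _).
    rewrite -!scalerA -scalerDr; congr (_ *: _).
    by rewrite scalerBl scalerBr [RHS]addrC addrA subrK.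
  apply: cvgD.
    by apply: cvgZr_tmp; rewrite -Da; exact: da_.
  apply: cvgZ; last by rewrite -Df; exact: df_.
  suff : {for 0, continuous (fun h : R => a (h *: 1 + t))}.
    by move=> /continuous_withinNx; rewrite scale0r add0r.
  apply/differentiable_continuous/derivable1_diffP/(derivable1P _ _ _).1.
  by case: da.
by split; [apply/cvg_ex; eexists; exact: C | exact: cvg_lim C].
Qed.

(** This is [mean_value_ineq] for F minus its candidate linear part, on the segment rescaled to
    [0, 1]. The bound has the shape required by [is_derive_epsP]. *)
Lemma mean_value_segment (V : normedModType R) (F : V -> W) (dF : R -> W) p v (s : R) A (e : R) :
  (forall t : R, `|t| <= `|s| ->
     is_derive (p + t *: v) v F (dF t) /\ `|dF t - A| <= e) ->
  `|F (p + s *: v) - F p - s *: A| <= e * `|s|.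
Proof.
move=> H; pose g t := F (p + (t * s) *: v) - (t * s) *: A.
have := @mean_value_ineq g (fun t => s *: (dF (t * s) - A)) (e * `|s|).
rewrite /g mul1r !mul0r !scale0r addr0 subr0 addrAC; apply=> t /andP[t0 t1].
have [|dFt le_e] := H (t * s).
  by rewrite normrM ger0_norm // ler_piMl.
split; last by rewrite normrZ mulrC ler_wpM2r.
rewrite scalerBr; apply: is_deriveB; last first.
  apply: is_derive_eq (is_derive1_scale _ (is_derive_cst A t 1)) _.
  by rewrite !scaler0 !addr0 add0r -[s%:A]/(s * 1) mulr1.
have ds : is_derive t (1 : R) ( *%R^~ s) s.
  by apply: is_derive_eq; rewrite scaler0 add0r -[s%:A]/(s * 1) mulr1.
by apply: (is_derive1_comp (f := fun u => F (p + u *: v)) ds); apply/is_derive_line.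
Qed.

(** The remainder bound for [Phi s] on a segment does not depend on s, so it survives the pointwise
    limit as s decreases to 0. *)
Lemma is_derive_approx (V : normedModType R) (Phi : R -> V -> W) (dPhi : R -> R -> W)
    (F : V -> W) p v A :
  (forall e : R, 0 < e -> exists2 d : R, 0 < d & forall s t : R, 0 < s < d -> `|t| < d ->
     is_derive (p + t *: v) v (Phi s) (dPhi s t) /\ `|dPhi s t - A| <= e) ->
  (exists2 d : R, 0 < d & forall t : R, `|t| < d ->
     Phi s (p + t *: v) @[s --> 0^'+] --> F (p + t *: v)) ->
  is_derive p v F A.
Proof.
move=> dP [d1 d10 PF]; apply/is_derive_epsP => e e0.
have [d2 d20 Hd] := dP e e0.
exists (Num.min d1 d2); first by rewrite lt_min d10.
move=> h; rewrite lt_min => /andP[h1 h2].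
have Cvg : `|Phi s (p + h *: v) - Phi s p - h *: A| @[s --> 0^'+] -->
    `|F (p + h *: v) - F p - h *: A|.
  apply: cvg_norm; apply: cvgB; last exact: cvg_cst.
  apply: cvgB; first exact: PF.
  by have := PF 0; rewrite normr0 scale0r addr0; exact.
apply: (cvgr_to_le Cvg).
near=> s; have s0d : 0 < s < d2.
  by apply/andP; split; near: s; [exact: nbhs_right_gt | exact: nbhs_right_lt].
apply: (@mean_value_segment _ (Phi s) (dPhi s)) => t th.
by apply: Hd => //; exact: le_lt_trans th h2.
Unshelve. all: by end_near. Qed.

Lemma near_plane (V : normedModType R) (P : set V) p u v :
  (\forall q \near p, P q) ->
  exists2 d : R, 0 < d & forall s t : R, `|s| < d -> `|t| < d -> P (p + t *: v + s *: u).
Proof.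
move=> /nbhs_normP[e /= e0 eP].
(* The summand 1 keeps the divisor positive even if u and v both vanish. *)
have D0 : 0 < `|u| + `|v| + 1 by rewrite ltr_wpDl // addr_ge0.
exists (e / (`|u| + `|v| + 1)); first exact: divr_gt0.
move=> s t; rewrite !ltr_pdivlMr // => sd td; apply: eP => /=.
rewrite -addrA opprD addrA subrr add0r normrN.
apply: (le_lt_trans (ler_normD _ _)); rewrite !normrZ.
have [st|/ltW st] := leP `|s| `|t|.
  apply: le_lt_trans td; rewrite 2!mulrDr mulr1 (addrC (_ * `|u|)) -addrA lerD2l.
  by rewrite -[leLHS]addr0 lerD // ler_wpM2r.
apply: le_lt_trans sd; rewrite 2!mulrDr mulr1 (addrC (_ * `|v|)) -addrA lerD2l.
by rewrite -[leLHS]addr0 lerD // ler_wpM2r.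
Qed.

Lemma near_line (V : normedModType R) (P : set V) p v :
  (\forall q \near p, P q) -> \forall s \near (0 : R), P (p + s *: v).
Proof.
move=> /(near_plane 0 v)[d d0 H]; apply/nbhs_normP; exists d => //= s /=.
rewrite sub0r normrN => sd.
by have := H 0 s; rewrite normr0 scale0r addr0; exact.
Qed.

Lemma is_derive_translate (V : normedModType R) (F : V -> W) q w v A :
  is_derive (q + w) v F A -> is_derive q v (fun x => F (x + w)) A.
Proof.
move=> /is_derive_epsP H; apply/is_derive_epsP => e /H[d d0 Hd].
by exists d => // h /Hd; rewrite (addrAC q w).
Qed.

(** The u-difference quotients of F tend to [Gu]; their v-derivatives are u-difference quotients of
    [Gv], which the mean value inequality puts close to [Guv p]. The derivative of [Gu] along v is
    thus obtained, not assumed. *)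
Lemma schwarz_derive (V : normedModType R) (F Gu Gv Guv : V -> W) p u v :
  (\forall q \near p, is_derive q u F (Gu q)) ->
  (\forall q \near p, is_derive q v F (Gv q)) ->
  (\forall q \near p, is_derive q u Gv (Guv q)) ->
  {for p, continuous Guv} ->
  is_derive p v Gu (Guv p).
Proof.
move=> /(near_plane u v)[d1 d10 Hu] /(near_plane u v)[d2 d20 Hv] Huv Cuv.
apply: (@is_derive_approx _ (fun s q => s^-1 *: (F (q + s *: u) - F q))
  (fun s t => s^-1 *: (Gv (p + t *: v + s *: u) - Gv (p + t *: v)))).
- move=> e e0.
  have : \forall q \near p, is_derive q u Gv (Guv q) /\ `|Guv q - Guv p| <= e.
    near=> q; split; first by near: q.
    by rewrite distrC; near: q; exact: cvgr_dist_le Cuv _ e0.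
  move=> /(near_plane u v)[d3 d30 Hq].
  exists (Num.min d2 d3); first by rewrite lt_min d20.
  move=> s t /andP[s0]; rewrite !lt_min => /andP[s2 s3] /andP[t2 t3].
  have abss : `|s| = s by rewrite gtr0_norm.
  split.
    apply: is_deriveZ; apply: is_deriveB.
      by apply: is_derive_translate; apply: Hv; rewrite ?abss.
    by have := Hv 0 t; rewrite scale0r addr0; apply => //; rewrite normr0.
  rewrite -(ler_pM2l s0) -[X in X * _ <= _]abss -normrZ scalerBr scalerA divff ?gt_eqF // scale1r.
  rewrite -[X in _ <= X * _]abss mulrC.
  apply: (@mean_value_segment _ Gv (fun x => Guv (p + t *: v + x *: u))) => x xs.
  by apply: Hq => //; rewrite (le_lt_trans xs) ?abss.
- exists d1 => // t td; have := Hu 0 t; rewrite scale0r addr0 normr0.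
  move=> /(_ d10 td)[dF <-].
  have := cvg_dnbhs_at_right dF; rewrite -/(derive _ _ _).
  by under eq_fun do rewrite /= (addrC _ (p + _)).
Unshelve. all: by end_near. Qed.

(** The vector w pushes the line through p along v off the set where the derivative of F is unknown;
    continuity of F brings the translates back. *)
Lemma is_derive_extend (V : normedModType R) (F G : V -> W) p v w :
  (\forall q \near p, {for q, continuous F}) -> {for p, continuous G} ->
  (exists2 d : R, 0 < d & forall s t : R, 0 < s < d -> `|t| < d ->
     is_derive (p + t *: v + s *: w) v F (G (p + t *: v + s *: w))) ->
  is_derive p v F (G p).
Proof.
move=> /(near_plane w v)[d1 d10 cF] cG [d2 d20 dF].
apply: (@is_derive_approx _ (fun s q => F (q + s *: w))
  (fun s t => G (p + t *: v + s *: w))).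
- move=> e e0.
  have /(near_plane w v)[d3 d30 Hd] : \forall q \near p, `|G p - G q| <= e.
    exact: cvgr_dist_le cG _ e0.
  exists (Num.min d2 d3); first by rewrite lt_min d20.
  move=> s t /andP[s0]; rewrite !lt_min => /andP[s2 s3] /andP[t2 t3]; split.
    by apply: is_derive_translate; apply: dF => //; rewrite s0.
  by rewrite distrC; have := Hd s t; rewrite gtr0_norm //; exact.
- exists d1 => // t td.
  have Ft : {for p + t *: v, continuous F}.
    by have := cF 0 t; rewrite scale0r addr0; apply => //; rewrite normr0.
  have cq : p + t *: v + s *: w @[s --> (0 : R)] --> p + t *: v.
    rewrite -[X in _ --> X]addr0 -(scale0r w); apply: cvgD; first exact: cvg_cst.
    by apply: cvgZr_tmp; exact: cvg_id.
  by apply: cvg_at_right_filter; exact: cvg_comp cq Ft.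
Qed.

Lemma is_derive_linear (V W' : normedModType R) (L : {linear W -> W'}) (F : V -> W) p v A :
  continuous L -> is_derive p v F A -> is_derive p v (L \o F) (L A).
Proof.
move=> cL [dF <-].
have C : (fun h => h^-1 *: (((L \o F) \o shift p) (h *: v) - (L \o F) p)) @ 0^'
    --> L ('D_v F p).
  rewrite (_ : (fun h => _) = L \o (fun h => h^-1 *: ((F \o shift p) (h *: v) - F p))).
    by apply: continuous_cvg => //; exact: cL.
  by apply/funext => h; rewrite /comp /= linearZ /= (linearB L).
by split; [apply/cvg_ex; eexists; exact: C | exact: cvg_lim C].
Qed.

End Calculus.

(** * Derivatives and continuity depend only on values in an open set *)

Section Local.
Variables (R : realType) (V W : normedModType R).

Lemma near_open (U : set V) (P : V -> Prop) p :
  open U -> U p -> (forall q, U q -> P q) -> \forall q \near p, P q.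
Proof. by move=> oU Up UP; apply: filterS (open_nbhs_nbhs (conj oU Up)). Qed.

Lemma is_derive_eq_on (U : set V) (F G : V -> W) p v A : open U -> U p ->
  (forall q, U q -> F q = G q) -> is_derive p v F A -> is_derive p v G A.
Proof.
by move=> oU Up FG; apply: near_eq_is_derive; exact: near_open oU Up FG.
Qed.

Lemma continuous_eq_on (U : set V) (F G : V -> W) p : open U -> U p ->
  (forall q, U q -> F q = G q) -> {for p, continuous F} -> {for p, continuous G}.
Proof.
move=> oU Up FG cF; rewrite /prop_for /continuous_at -FG //.
by apply: cvg_trans cF; apply: near_eq_cvg; exact: near_open oU Up FG.
Qed.

Lemma is_derive_derive (F : V -> W) p v A : is_derive p v F A -> 'D_v F p = A.
Proof. by case. Qed.

Lemma is_derive_derivable (F : V -> W) p v A : is_derive p v F A -> derivable F p v.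
Proof. by case. Qed.

End Local.

(** * Closure properties of the class C^m on an open set *)

Section Cm.
Variables (R : realType) (W : normedModType R) (U : set (R * R * R)).
Hypothesis oU : open U.
Implicit Types F G : R * R * R -> W.

Lemma is_Cm_continuous m F p : is_Cm m U F -> U p -> {for p, continuous F}.
Proof. by case: m => [|m] [cF _]; exact: cF. Qed.

Lemma is_Cm_derive m F e : is_Cm m.+1 U F ->
  [\/ e = (1, 0, 0), e = (0, 1, 0) | e = (0, 0, 1)] ->
  (forall p, U p -> derivable F p e) /\ is_Cm m U ('D_e F).
Proof. by move=> [_]; apply. Qed.

Lemma is_Cm_eq_on m F G : (forall p, U p -> F p = G p) -> is_Cm m U F -> is_Cm m U G.
Proof.
elim: m F G => [|m IH] F G FG [cF dF].
  by split=> // p Up; exact: (continuous_eq_on oU Up FG (cF p Up)).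
split=> [p Up|e he]; first by exact: (continuous_eq_on oU Up FG (cF p Up)).
have [dFe CmF] := dF e he.
have dG p : U p -> is_derive p e G ('D_e F p).
  by move=> Up; apply: (is_derive_eq_on oU Up FG); exact/derivableP/dFe.
split; first by move=> p Up; exact: is_derive_derivable (dG p Up).
by apply: (IH ('D_e F)) => // p Up; rewrite (is_derive_derive (dG p Up)).
Qed.

(** The candidate G has to agree with the derivative on U only, so it may be given by a formula that
    differs from ['D_e F] elsewhere. *)
Lemma is_CmS m F : (forall p, U p -> {for p, continuous F}) ->
  (forall e, [\/ e = (1, 0, 0), e = (0, 1, 0) | e = (0, 0, 1)] ->
     exists2 G, is_Cm m U G & forall p, U p -> is_derive p e F (G p)) ->
  is_Cm m.+1 U F.
Proof.
move=> cF dF; split=> // e /dF[G CmG dG]; split.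
  by move=> p Up; exact: is_derive_derivable (dG p Up).
by apply: is_Cm_eq_on CmG => p Up; rewrite (is_derive_derive (dG p Up)).
Qed.

Lemma is_CmD m F G : is_Cm m U F -> is_Cm m U G -> is_Cm m U (F \+ G).
Proof.
elim: m F G => [|m IH] F G [cF dF] [cG dG].
  by split=> // p Up; apply: continuousD; [exact: cF|exact: cG].
apply: is_CmS => [p Up|e he].
  by apply: continuousD; [exact: cF|exact: cG].
have [[dFe CmF] [dGe CmG]] := (dF e he, dG e he).
exists ('D_e F \+ 'D_e G); first exact: IH.
by move=> p Up; apply: is_deriveD; apply/derivableP; [exact: dFe|exact: dGe].
Qed.

Lemma is_Cm_linear m (L : {linear W -> W}) F :
  continuous L -> is_Cm m U F -> is_Cm m U (L \o F).
Proof.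
move=> cL; elim: m F => [|m IH] F [cF dF].
  by split=> // p Up; apply: continuous_comp; [exact: cF|exact: cL].
apply: is_CmS => [p Up|e he].
  by apply: continuous_comp; [exact: cF|exact: cL].
have [dFe CmF] := dF e he.
exists (L \o 'D_e F); first exact: IH.
by move=> p Up; apply: is_derive_linear => //; exact/derivableP/dFe.
Qed.

Lemma is_CmB m F G : is_Cm m U F -> is_Cm m U G -> is_Cm m U (F \- G).
Proof.
move=> CF CG; apply: (is_Cm_eq_on (F := F \+ ((-1 : R) \*: G))) => [p _|].
  by rewrite /= scaleN1r.
apply: is_CmD => //; apply: (is_Cm_linear (L := *:%R (-1 : R))) => //.
exact: scaler_continuous.
Qed.

End Cm.

(** * Operators on the half strip *)

Section Strip.
Variables (R : realType) (W : normedModType R) (rho : R).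
Implicit Types (f g h u : R * R -> W) (j k : int).
Local Notation S := (open_half_strip rho).

Lemma open_half_strip_open : open S.
Proof.
rewrite (_ : S = fst @^-1` `]0, rho[%classic).
  apply: open_comp; last exact: interval_open.
  by move=> p _; exact: cvg_fst.
by apply/seteqP; split => p; rewrite /= in_itv.
Qed.

Let oS := open_half_strip_open.

Definition eq_strip f g := forall p, S p -> f p = g p.

Lemma eq_strip_sym f g : eq_strip f g -> eq_strip g f.
Proof. by move=> fg p Sp; rewrite fg. Qed.

Lemma eq_strip_trans g f h : eq_strip f g -> eq_strip g h -> eq_strip f h.
Proof. by move=> fg gh p Sp; rewrite fg // gh. Qed.

Lemma derivable_eq_strip f g p v :
  eq_strip f g -> S p -> derivable f p v -> derivable g p v.
Proof.
move=> fg Sp /derivableP df.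
exact: is_derive_derivable (is_derive_eq_on oS Sp fg df).
Qed.

Lemma derive_eq_strip f g v : eq_strip f g -> eq_strip ('D_v f) ('D_v g).
Proof.
by move=> fg p Sp; apply: near_eq_derive; exact: near_open oS Sp fg.
Qed.

Lemma radD_eq_strip j f g : eq_strip f g -> eq_strip (radD j f) (radD j g).
Proof.
move=> fg p Sp; rewrite /radD fg //; congr (_ + _); exact: derive_eq_strip.
Qed.

Lemma radD_iter_eq_strip n j f g :
  eq_strip f g -> eq_strip (radD_iter n j f) (radD_iter n j g).
Proof. by move=> fg; elim: n => //= n IH; exact: radD_eq_strip. Qed.

Lemma iter_partial_z_eq_strip n f g :
  eq_strip f g -> eq_strip (iter n (@partial_z R W) f) (iter n (@partial_z R W) g).
Proof. by move=> fg; elim: n => //= n IH; exact: derive_eq_strip. Qed.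

Lemma has_partial_z_iter_eq_strip n f g :
  eq_strip f g -> has_partial_z_iter rho n f -> has_partial_z_iter rho n g.
Proof.
move=> fg H l ln p Sp; apply: derivable_eq_strip (H l ln p Sp) => //.
exact: iter_partial_z_eq_strip.
Qed.

Lemma has_radD_iter_eq_strip n j f g :
  eq_strip f g -> has_radD_iter rho n j f -> has_radD_iter rho n j g.
Proof.
move=> fg H l ln p Sp; apply: derivable_eq_strip (H l ln p Sp) => //.
exact: radD_iter_eq_strip.
Qed.

Lemma extends_C0_rad_eq_strip j f g :
  eq_strip f g -> extends_C0_rad rho j f -> extends_C0_rad rho j g.
Proof. by move=> fg [h hC hf]; exists h => // p Sp; rewrite hf // fg. Qed.

(** The definition unfolds at the outermost operator, whereas the inductions on the order peel off
    the innermost one. *)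
Lemma radD_iterSr n j f : radD_iter n.+1 j f = radD_iter n (j - 1) (radD j f).
Proof.
elim: n => [|n IH]; first by rewrite /= subr0.
by rewrite -[LHS]/(radD (j - n.+1%:Z) (radD_iter n.+1 j f)) IH /=; congr radD; lia.
Qed.

Lemma has_radD_iterS n j f : has_radD_iter rho n.+1 j f <->
  (forall p, S p -> derivable f p (1, 0)) /\ has_radD_iter rho n (j - 1) (radD j f).
Proof.
split=> [H|[H0 H] [|l] ln p Sp]; last 2 first.
- exact: H0.
- by rewrite radD_iterSr; exact: H.
split=> [p Sp|l ln p Sp]; first exact: (H 0%N).
by rewrite -radD_iterSr; exact: (H l.+1).
Qed.

Lemma has_partial_z_iterS n f : has_partial_z_iter rho n.+1 f <->
  (forall p, S p -> derivable f p (0, 1)) /\ has_partial_z_iter rho n (partial_z f).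
Proof.
split=> [H|[H0 H] [|l] ln p Sp]; last 2 first.
- exact: H0.
- by rewrite iterSr; exact: H.
split=> [p Sp|l ln p Sp]; first exact: (H 0%N).
by rewrite -iterSr; exact: (H l.+1).
Qed.

Lemma C0_rad_continuous j g p : C0_rad rho j g -> S p -> {for p, continuous g}.
Proof.
move=> [cg _] Sp.
have : {within S, continuous g}.
  by apply: continuous_subspaceW cg => q /andP[q0 q1]; apply/andP; rewrite ltW.
by rewrite continuous_open_subspace //; apply; rewrite inE.
Qed.

Lemma extends_C0_rad_continuous j h p :
  extends_C0_rad rho j h -> S p -> {for p, continuous h}.
Proof.
move=> [g gC gh] Sp; apply: (continuous_eq_on oS Sp gh).
exact: C0_rad_continuous gC Sp.
Qed.

Lemma is_derive_divr j u (p : R * R) A : p.1 != 0 -> is_derive p ((1, 0) : R * R) u A ->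
  is_derive p ((1, 0) : R * R) (fun q => (j%:~R / q.1) *: u q)
    ((- (j%:~R / p.1 ^+ 2)) *: u p + (j%:~R / p.1) *: A).
Proof.
move=> p0 /is_derive_line0 du; apply/is_derive_line0.
have da : is_derive (0 : R) (1 : R) (fun s : R => j%:~R / (p + s *: ((1, 0) : R * R)).1)
    (- (j%:~R / p.1 ^+ 2)).
  rewrite (_ : (fun s : R => _) = j%:~R \*: (fun s : R => (p.1 + s)^-1)); last first.
    by apply/funext => s; rewrite /= -[s%:A]/(s * 1) mulr1.
  have : is_derive (0 : R) (1 : R) (fun s : R => p.1 + s) 1.
    by have := is_deriveD (is_derive_cst p.1 (0 : R) 1) (is_derive_id (0 : R) 1); rewrite add0r.
  move=> /is_deriveV; rewrite addr0 => /(_ p0) /(is_deriveZ j%:~R).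
  move=> H; apply: is_derive_eq H _.
  by rewrite -[_ *: 1]/(_ * 1) mulr1 -[_ *: _]/(_ * _) mulrN.
have := is_derive1_scale da du.
by rewrite scale0r addr0.
Qed.

Lemma is_derive_divz j u (p : R * R) A : is_derive p ((0, 1) : R * R) u A ->
  is_derive p ((0, 1) : R * R) (fun q => (j%:~R / q.1) *: u q) ((j%:~R / p.1) *: A).
Proof.
move=> /is_derive_line0 du; apply/is_derive_line0.
have := is_deriveZ (j%:~R / p.1) du.
rewrite (_ : _ \*: _ = (fun s : R => (j%:~R / (p + s *: ((0, 1) : R * R)).1) *:
  u (p + s *: ((0, 1) : R * R)))) //.
by apply/funext => s; rewrite /= -[_ *: 0]/(_ * 0) mulr0 addr0.
Qed.

Lemma partial_rE j h : partial_r h = fun p => radD j h p - (j%:~R / p.1) *: h p.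
Proof. by apply/funext => p; rewrite /radD addrK. Qed.

(** The factor j/r is constant in z, so only [partial_r h] calls for Schwarz's theorem. The
    continuity of the mixed derivative required there comes from D_j D_z h by subtracting (j/r) D_z
    h, which is harmless off the axis. *)
Lemma is_derive_radD_z j h :
  (forall p, S p -> derivable h p (1, 0)) ->
  (forall p, S p -> derivable h p (0, 1)) ->
  (forall p, S p -> derivable (partial_z h) p (1, 0)) ->
  (forall p, S p -> {for p, continuous (partial_z h)}) ->
  (forall p, S p -> {for p, continuous (radD j (partial_z h))}) ->
  forall p, S p -> is_derive p ((0, 1) : R * R) (radD j h) (radD j (partial_z h) p).
Proof.
move=> hr hz hzr cz cDz p Sp; have /andP[p0 _] := Sp.
rewrite /radD; apply: is_deriveD; last by apply: is_derive_divz; exact/derivableP/hz.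
apply: (schwarz_derive (Gu := partial_r h) (Guv := partial_r (partial_z h))
          (F := h) (Gv := partial_z h) (u := (1, 0))).
- by apply: (near_open oS Sp) => q Sq; exact/derivableP/hr.
- by apply: (near_open oS Sp) => q Sq; exact/derivableP/hz.
- by apply: (near_open oS Sp) => q Sq; exact/derivableP/hzr.
- rewrite (partial_rE j); apply: continuousB; first exact: cDz.
  apply: cvgZ; last exact: cz.
  apply: cvgM; first exact: cvg_cst.
  by apply: cvgV; [rewrite gt_eqF|exact: cvg_fst].
Qed.

(* Both sides are the radial Laplacian u_rr + u_r / r - j^2 u / r^2 of mode j. *)
Lemma radD_laplacian j u p : S p ->
  (forall q, S q -> derivable u q (1, 0)) ->
  (forall q, S q -> derivable (radD (- j) u) q (1, 0)) ->
  radD (j + 1) (radD (- j) u) p = radD (- j + 1) (radD j u) p.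
Proof.
move=> Sp du dDu; have /andP[p0 _] := Sp.
have p1 : p.1 != 0 by rewrite gt_eqF.
have dr i : is_derive p ((1, 0) : R * R) (fun q => (i%:~R / q.1) *: u q)
    ((- (i%:~R / p.1 ^+ 2)) *: u p + (i%:~R / p.1) *: partial_r u p).
  by apply: is_derive_divr => //; exact/derivableP/du.
(* The second radial derivative exists because u_r = D_{-j} u + (j/r) u is a sum of derivable
   functions. *)
have [B dB] : exists B, is_derive p ((1, 0) : R * R) (partial_r u) B.
  have := is_deriveB (derivableP (dDu p Sp)) (dr (- j)).
  rewrite (_ : radD (- j) u - _ = partial_r u); last first.
    by apply/funext => q; rewrite [LHS]addrK.
  by move=> dB; eexists; exact: dB.
have dD i : 'D_(1, 0) (radD i u) p = B +
    ((- (i%:~R / p.1 ^+ 2)) *: u p + (i%:~R / p.1) *: partial_r u p).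
  by apply: is_derive_derive; apply: is_deriveD.
rewrite /radD /partial_r -/(radD _ u) !dD -/(partial_r u) !scalerDr !scalerA.
have key (a1 a2 a3 a4 : R) : B + (a1 *: u p + a2 *: partial_r u p) +
    (a3 *: partial_r u p + (a3 * a4) *: u p) =
    B + (a2 + a3) *: partial_r u p + (a1 + a3 * a4) *: u p.
  rewrite !scalerDl !addrA -!addrA; congr (_ + _).
  by rewrite [LHS]addrCA; congr (_ + _); exact: addrCA.
rewrite !key !rmorphD !rmorphN /=.
congr (_ + _ *: _ + _ *: _); field.
all: by [].
Qed.

(** All hypotheses concern the z-derivatives of f; that [radD j f] can be derived in z is part of
    the conclusion, gained one order at a time from [is_derive_radD_z]. *)
Lemma iter_partial_z_radD q j f :
  has_partial_z_iter rho q f ->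
  (forall l p, (l <= q)%N -> S p ->
    [/\ derivable (iter l (@partial_z R W) f) p (1, 0),
        {for p, continuous (iter l (@partial_z R W) f)} &
        {for p, continuous (radD j (iter l (@partial_z R W) f))}]) ->
  eq_strip (iter q (@partial_z R W) (radD j f)) (radD j (iter q (@partial_z R W) f)) /\
  has_partial_z_iter rho q (radD j f).
Proof.
elim: q => [|q IH] hz hf; first by split.
have [|l p lq Sp|E hzq] := IH.
- by move=> l lq; apply: hz; exact: ltnW.
- by apply: hf => //; exact: leqW.
have dz p : S p -> is_derive p ((0, 1) : R * R) (radD j (iter q (@partial_z R W) f))
    (radD j (iter q.+1 (@partial_z R W) f) p).
  move=> Sp; apply: is_derive_radD_z => // r Sr.
  - by have [] := hf q r (leqnSn q) Sr.
  - exact: hz.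
  - by have [] := hf q.+1 r (leqnn _) Sr.
  - by have [] := hf q.+1 r (leqnn _) Sr.
  - by have [] := hf q.+1 r (leqnn _) Sr.
split=> [p Sp|l]; last first.
  rewrite ltnS leq_eqVlt => /predU1P[->|lq] p Sp; last exact: hzq.
  apply: (derivable_eq_strip (eq_strip_sym E) Sp).
  exact: is_derive_derivable (dz p Sp).
by rewrite /= /partial_z (derive_eq_strip _ E) // (is_derive_derive (dz p Sp)).
Qed.

(** D_{-k} travels outwards through D_{k+1}^l: each exchange is [radD_laplacian] at index k - l and
    raises the travelling index by one. The two derivatives in the hypothesis are what that identity
    consumes. *)
Lemma radD_iter_raise i k h :
  (forall l, (l < i)%N -> has_radD_iter rho 2 (- k + l%:Z) (radD_iter l k h)) ->
  forall l, (l <= i)%N ->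
  eq_strip (radD_iter l (k + 1) (radD (- k) h)) (radD (- k + l%:Z) (radD_iter l k h)).
Proof.
move=> H; elim=> [|l IH] li; first by rewrite addr0.
apply: (eq_strip_trans (radD_eq_strip _ (IH (ltnW li)))) => p Sp.
have := @radD_laplacian (k - l%:Z) (radD_iter l k h) p Sp.
rewrite (_ : k - l%:Z + 1 = k + 1 - l%:Z) 1?(_ : - (k - l%:Z) = - k + l%:Z); [|lia|lia].
move=> -> //; first by congr (radD _ _ _); lia.
- by move=> q Sq; exact: (H l li 0%N).
- by move=> q Sq; have := H l li 1%N isT q Sq; rewrite /= subr0.
Qed.

Lemma has_radD_iter_raise i k h :
  (forall l, (l < i)%N -> has_radD_iter rho 2 (- k + l%:Z) (radD_iter l k h)) ->
  has_radD_iter rho i (k + 1) (radD (- k) h).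
Proof.
move=> H l li p Sp.
apply: (derivable_eq_strip (eq_strip_sym (radD_iter_raise H (ltnW li))) Sp).
by have := H l li 1%N isT p Sp; rewrite /= subr0.
Qed.

(** * Stability of C^(m+1)_(k) under D_z, D_k and D_{-k} *)

Section Steps.
Variables (m : nat) (k : int) (f : R * R -> W).
Hypothesis fC : Cm_rad rho m.+1 k f.

(** This and the next two lemmas read off the entries (i, n, p) = (0, 0, 1), (1, 1, 1) and (0, 1,
    1), whose extensions serve as radial coefficients of the images of F. *)
Lemma Cm_radS_z :
  (forall p, S p -> derivable f p (0, 1)) /\ extends_C0_rad rho k (partial_z f).
Proof.
have [hz _ _ +] := fC.2 0%N 0%N 1%N isT isT isT; rewrite /= addr0 subr0.
by move=> ext; split=> // p Sp; exact: (hz 0%N).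
Qed.

Lemma Cm_radS_lower :
  (forall p, S p -> derivable f p (1, 0)) /\ extends_C0_rad rho (k - 1) (radD k f).
Proof.
have [_ hr _ +] := fC.2 1%N 1%N 1%N isT isT isT; rewrite /= subr0.
rewrite (_ : k + 1 - 2%:Z = k - 1); last lia.
by move=> ext; split=> // p Sp; exact: (hr 0%N).
Qed.

Lemma Cm_radS_raise : extends_C0_rad rho (k + 1) (radD (- k) f).
Proof.
by have [_ _ _ +] := fC.2 0%N 1%N 1%N isT isT isT; rewrite /= addr0 !subr0.
Qed.

(** The entry (i, n, p) of g is the entry (i, n, p + 1) of f. A separate g is needed because
    [C0_rad] looks at r = 0, where [partial_z f] need not be the extension. *)
Lemma Cm_rad_partial_z g : C0_rad rho k g -> eq_strip (partial_z f) g -> Cm_rad rho m k g.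
Proof.
move=> gC fg; split=> // i n p lein lenp lepm.
have [] := fC.2 i n p.+1 lein (leqW lenp) lepm.
rewrite subSn // iterSr.
set fz := iter _ _ _; set gz := iter _ _ g => hz hr hr2 ext.
have E : eq_strip fz gz by exact: iter_partial_z_eq_strip.
have E2 : eq_strip (radD_iter i k fz) (radD_iter i k gz) by exact: radD_iter_eq_strip.
split.
- by move/has_partial_z_iterS: hz => [_]; exact: has_partial_z_iter_eq_strip.
- exact: has_radD_iter_eq_strip hr.
- exact: has_radD_iter_eq_strip hr2.
- by apply: extends_C0_rad_eq_strip ext; exact: radD_iter_eq_strip.
Qed.

(** These are the hypotheses of [iter_partial_z_radD], from the entries (0, 0, l), (0, 1, l + 1) and
    (1, 1, l + 1). *)
Lemma Cm_rad_iter_partial_z l p : (l <= m)%N -> S p ->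
  [/\ derivable (iter l (@partial_z R W) f) p (1, 0),
      {for p, continuous (iter l (@partial_z R W) f)},
      {for p, continuous (radD k (iter l (@partial_z R W) f))} &
      {for p, continuous (radD (- k) (iter l (@partial_z R W) f))}].
Proof.
move=> lm Sp.
have [] := fC.2 0%N 0%N l isT isT (leqW lm).
have [] := fC.2 1%N 1%N l.+1 isT isT lm.
have [] := fC.2 0%N 1%N l.+1 isT isT lm.
rewrite !subSS !subn0 /= !subr0 ?addr0 => + + + e1 + hr + e2 + + + e3.
rewrite (_ : k + 1 - 2%:Z = k - 1) in e2; last lia.
move=> *; split.
- exact: (hr 0%N).
- exact: extends_C0_rad_continuous e3 Sp.
- exact: extends_C0_rad_continuous e2 Sp.
- exact: extends_C0_rad_continuous e1 Sp.
Qed.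

(** The entry (i, n, p) of g is the entry (i + 1, n + 1, p + 1) of f once D_k has been moved past
    the z-derivatives. *)
Lemma Cm_rad_lower g :
  C0_rad rho (k - 1) g -> eq_strip (radD k f) g -> Cm_rad rho m (k - 1) g.
Proof.
move=> gC fg; split=> // i n p lein lenp lepm.
have [hz hr hr2 ext] := fC.2 i.+1 n.+1 p.+1 lein lenp lepm.
rewrite subSS in hz hr hr2 ext; rewrite subSS in hr2 ext.
have qm : (p - n <= m)%N := leq_trans (leq_subr _ _) lepm.
have [|Ez hzD] := @iter_partial_z_radD (p - n) k f hz.
  by move=> l q lq Sq; have [] := @Cm_rad_iter_partial_z l q (leq_trans lq qm) Sq.
set fz := iter _ _ f in hz hr hr2 ext Ez.
rewrite /=; set gz := iter _ _ g.
have E : eq_strip (radD k fz) gz.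
  exact: eq_strip_trans (eq_strip_sym Ez) (iter_partial_z_eq_strip _ fg).
have Ei : eq_strip (radD_iter i.+1 k fz) (radD_iter i (k - 1) gz).
  by rewrite radD_iterSr; exact: radD_iter_eq_strip.
rewrite (_ : - (k - 1) + i%:Z = - k + i.+1%:Z); last lia.
rewrite (_ : k - 1 + n%:Z - (2 * i)%N%:Z = k + n.+1%:Z - (2 * i.+1)%N%:Z); last lia.
split.
- exact: has_partial_z_iter_eq_strip hzD.
- by move/has_radD_iterS: hr => [_]; exact: has_radD_iter_eq_strip.
- exact: has_radD_iter_eq_strip hr2.
- by apply: extends_C0_rad_eq_strip ext; exact: radD_iter_eq_strip.
Qed.

(** The entry (i, n, p) of g is the entry (i, n + 1, p + 1) of f once D_{-k} has been moved past the
    z-derivatives and then past D_k^i. *)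
Lemma Cm_rad_raise g :
  C0_rad rho (k + 1) g -> eq_strip (radD (- k) f) g -> Cm_rad rho m (k + 1) g.
Proof.
move=> gC fg; split=> // i n p lein lenp lepm.
have [hz _ hr2 ext] := fC.2 i n.+1 p.+1 (leqW lein) lenp lepm.
rewrite subSS in hz hr2 ext; rewrite subSn // in hr2 ext.
have qm : (p - n <= m)%N := leq_trans (leq_subr _ _) lepm.
have [|Ez hzD] := @iter_partial_z_radD (p - n) (- k) f hz.
  by move=> l q lq Sq; have [] := @Cm_rad_iter_partial_z l q (leq_trans lq qm) Sq.
(* The entry with n = l + 2 allows two operators after D_k^l. Its order l + 2 + (p - n) is at most p
   + 1, because l < i <= n. *)
have H l : (l < i)%N ->
    has_radD_iter rho 2 (- k + l%:Z) (radD_iter l k (iter (p - n) (@partial_z R W) f)).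
  move=> li; have [] := fC.2 l l.+2 (l.+2 + (p - n))%N; [lia|lia|lia|].
  by rewrite addKn (_ : (l.+2 - l)%N = 2) //; lia.
set fz := iter _ _ f in hz hr2 ext Ez H.
rewrite /=; set gz := iter _ _ g.
have E : eq_strip (radD (- k) fz) gz.
  exact: eq_strip_trans (eq_strip_sym Ez) (iter_partial_z_eq_strip _ fg).
have Ei : eq_strip (radD (- k + i%:Z) (radD_iter i k fz)) (radD_iter i (k + 1) gz).
  apply: eq_strip_trans (radD_iter_eq_strip _ _ E).
  by apply: eq_strip_sym; exact: (radD_iter_raise H).
rewrite (_ : - (k + 1) + i%:Z = - k + i%:Z - 1); last lia.
rewrite (_ : k + 1 + n%:Z - (2 * i)%N%:Z = k + n.+1%:Z - (2 * i)%N%:Z); last lia.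
rewrite radD_iterSr in ext; move/has_radD_iterS: hr2 => [_ hr2].
split.
- exact: has_partial_z_iter_eq_strip hzD.
- exact: has_radD_iter_eq_strip (has_radD_iter_raise H).
- exact: has_radD_iter_eq_strip hr2.
- by apply: extends_C0_rad_eq_strip ext; exact: radD_iter_eq_strip.
Qed.

End Steps.

Lemma Cm_rad0 k f : C0_rad rho k f -> Cm_rad rho 0 k f.
Proof.
move=> fC; split=> // i n p; rewrite !leqn0 => + + /eqP p0; rewrite p0 leqn0.
move=> + /eqP n0; rewrite n0 leqn0 => /eqP ->; split=> //.
by exists f => //; rewrite /= addr0 subr0.
Qed.

(** Each entry has an innermost operator to peel off: D_z if n < p, otherwise D_k if i > 0 and
    D_{-k} if i = 0 < n. What remains is an entry of [g3], [g1] or [g2]. *)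
Lemma Cm_radS m k f g1 g2 g3 : C0_rad rho k f ->
  (forall p, S p -> derivable f p (1, 0)) -> (forall p, S p -> derivable f p (0, 1)) ->
  eq_strip g1 (radD k f) -> Cm_rad rho m (k - 1) g1 ->
  eq_strip g2 (radD (- k) f) -> Cm_rad rho m (k + 1) g2 ->
  eq_strip g3 (partial_z f) -> Cm_rad rho m k g3 ->
  Cm_rad rho m.+1 k f.
Proof.
move=> fC fr fz E1 [_ C1] E2 [_ C2] E3 [_ C3]; split=> // i n p lein lenp lepm.
case: (ltnP n p) => [ltnp|lepn].
  case: p lepm ltnp {lenp} => // p; rewrite ltnS => lepm lenp.
  have [hz hr hr2 ext] := C3 i n p lein lenp lepm.
  rewrite subSn // iterSr => gz gi.
  have Ez : eq_strip (iter (p - n) (@partial_z R W) g3) gz.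
    exact: iter_partial_z_eq_strip.
  have Ei : eq_strip (radD_iter i k (iter (p - n) (@partial_z R W) g3)) gi.
    exact: radD_iter_eq_strip.
  split.
  - apply/has_partial_z_iterS; split=> //.
    exact: has_partial_z_iter_eq_strip hz.
  - exact: has_radD_iter_eq_strip hr.
  - exact: has_radD_iter_eq_strip hr2.
  - by apply: extends_C0_rad_eq_strip ext; exact: radD_iter_eq_strip.
have -> : p = n by apply/eqP; rewrite eqn_leq lepn lenp.
have lenm : (n <= m.+1)%N := leq_trans lenp lepm.
rewrite subnn /=.
case: i lein => [|i] lein.
  case: n {lenp lepn lein} lenm => [|n] lenm.
    by have [_ /(_ 0%N 0%N 0%N isT isT isT)[]] := Cm_rad0 fC.
  have [] := C2 0%N n n isT (leqnn _) lenm.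
  have e0 : - k + 0%:Z = - k by lia.
  have e1 : - (k + 1) + 0%:Z = - k - 1 by lia.
  rewrite subnn subn0 e0 e1 => _ _ hr2 ext; split=> //.
    by apply/has_radD_iterS; split=> //; exact: has_radD_iter_eq_strip E2 hr2.
  rewrite [radD_iter 0 _ _]/= subn0 radD_iterSr.
  rewrite (_ : k + n.+1%:Z - (2 * 0)%N%:Z = k + 1 + n%:Z - (2 * 0)%N%:Z); last lia.
  by apply: extends_C0_rad_eq_strip ext; exact: radD_iter_eq_strip.
case: n {lenp lepn} lein lenm => // n; rewrite !ltnS => lein lenm.
have [] := C1 i n n lein (leqnn _) lenm.
rewrite subnn subSS => _ hr hr2 ext.
have Ei : eq_strip (radD_iter i (k - 1) g1) (radD_iter i.+1 k f).
  by rewrite radD_iterSr; exact: radD_iter_eq_strip.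
rewrite -/(radD_iter i.+1 k f).
rewrite (_ : - (k - 1) + i%:Z = - k + i.+1%:Z) in hr2 ext; last lia.
rewrite (_ : k - 1 + n%:Z - (2 * i)%N%:Z = k + n.+1%:Z - (2 * i.+1)%N%:Z) in ext; last lia.
split=> //.
- apply/has_radD_iterS; split=> //.
  exact: has_radD_iter_eq_strip hr.
- exact: has_radD_iter_eq_strip hr2.
- by apply: extends_C0_rad_eq_strip ext; exact: radD_iter_eq_strip.
Qed.

End Strip.

(** * Modes on the cylinder *)

Section Polar.
Variable R : realType.
Implicit Types (r t : R) (p : R * R * R).

Definition polar r t (z : R) : R * R * R := (r * cos t, r * sin t, z).

Definition rad p : R := Num.sqrt (p.1.1 ^+ 2 + p.1.2 ^+ 2).

(** With [tangential], the coordinates of the horizontal part of p in the frame rotated by t. *)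
Definition radial t p : R := p.1.1 * cos t + p.1.2 * sin t.

Definition tangential t p : R := p.1.2 * cos t - p.1.1 * sin t.

(** The branch of the polar angle on the half plane [radial t p > 0] that equals t on its central
    ray. Choosing t at a given point makes it smooth there, so no global argument function is
    involved. *)
Definition angle t p : R := t + atan (tangential t p / radial t p).

Lemma rad_polar r t z : 0 <= r -> rad (polar r t z) = r.
Proof.
move=> r0; rewrite /rad /= !exprMn -mulrDr cos2Dsin2 mulr1 sqrtr_sqr.
exact: ger0_norm.
Qed.

(** The angle is acos (x / r), with the sign of y. *)
Lemma polarP (x y z : R) : exists2 r, 0 <= r & exists t, (x, y, z) = polar r t z.
Proof.
pose r := Num.sqrt (x ^+ 2 + y ^+ 2).
have r2 : r ^+ 2 = x ^+ 2 + y ^+ 2 by rewrite sqr_sqrtr // addr_ge0 ?sqr_ge0.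
exists r; first exact: sqrtr_ge0.
have [r0|r0] := eqVneq r 0.
  exists 0; move/eqP: r2; rewrite r0 expr0n /= eq_sym paddr_eq0 ?sqr_ge0 //.
  by rewrite !sqrf_eq0 => /andP[/eqP -> /eqP ->]; rewrite /polar !mul0r.
have rp : 0 < r by rewrite lt_neqAle eq_sym r0 sqrtr_ge0.
have u2 : (x / r) ^+ 2 + (y / r) ^+ 2 = 1.
  by rewrite !expr_div_n -mulrDl -r2 divff // expf_neq0.
have u1 : -1 <= x / r <= 1.
  by move: u2; set u := x / r; set v := y / r => uv; apply/andP; split; nra.
have rK w : r * (w / r) = w by rewrite mulrCA divff // mulr1.
have ca : cos (acos (x / r)) = x / r by rewrite acosK // in_itv.
have sa : sin (acos (x / r)) = `|y / r|.
  by rewrite sin_acos // -sqrtr_sqr -u2 addrC addKr.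
have [y0|y0] := leP 0 y.
  exists (acos (x / r)); rewrite /polar ca sa ger0_norm; last exact: divr_ge0 y0 (ltW rp).
  by rewrite !rK.
exists (- acos (x / r)); rewrite /polar cosN sinN ca sa ler0_norm; last first.
  by rewrite pmulr_lle0 ?invr_gt0 // ltW.
by rewrite opprK !rK.
Qed.

(** In the rotated frame p is (a, b) with a > 0, and cos (atan u) = 1 / sqrt (1 + u^2) at u = b / a
    recovers a and b; the addition formulas rotate back. *)
Lemma polar_angle t p : 0 < radial t p -> p = polar (rad p) (angle t p) p.2.
Proof.
move=> a0; case: p a0 => [[x y] z] a0; rewrite /polar /angle /=.
set a := radial t _ in a0 *; set b := tangential t _.
have cs := cos2sin2 t.
have xE : x = a * cos t - b * sin t.
  by rewrite /a /b /radial /tangential /=; ring: cs.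
have yE : y = a * sin t + b * cos t.
  by rewrite /a /b /radial /tangential /=; ring: cs.
have ab : x ^+ 2 + y ^+ 2 = a ^+ 2 + b ^+ 2 by rewrite xE yE; ring: cs.
have an : a != 0 by rewrite gt_eqF.
have rc : rad (x, y, z) * cos (atan (b / a)) = a.
  have -> : rad (x, y, z) = a * Num.sqrt (1 + (b / a) ^+ 2).
    rewrite -[X in X * _](ger0_norm (ltW a0)) -sqrtr_sqr -sqrtrM ?sqr_ge0 //.
    by rewrite /rad /= ab; congr Num.sqrt; field.
  rewrite cos_atan mulfK // gt_eqF // sqrtr_gt0.
  by rewrite ltr_pwDl // sqr_ge0.
have rs : rad (x, y, z) * sin (atan (b / a)) = b.
  have cn : cos (atan (b / a)) != 0.
    by apply: contra_eq_neq rc => ->; rewrite mulr0 eq_sym.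
  have -> : sin (atan (b / a)) = b / a * cos (atan (b / a)).
    by rewrite -{2}(atanK (b / a)) /tan mulfVK.
  by rewrite mulrCA rc mulfVK.
by rewrite cosD sinD mulrBr mulrDr !(mulrCA (rad _)) rc rs; congr (_, _, _); rewrite ?xE ?yE; ring.
Qed.

Lemma radial_polar r t z : radial t (polar r t z) = r.
Proof. by rewrite /radial /= -!mulrA -mulrDr -!expr2 cos2Dsin2 mulr1. Qed.

Lemma tangential_polar r t z : tangential t (polar r t z) = 0.
Proof. by rewrite /tangential /=; ring. Qed.

Lemma angle_polar r t z : angle t (polar r t z) = t.
Proof. by rewrite /angle tangential_polar mul0r atan0 addr0. Qed.

Let continuous_x : continuous (fun p : R * R * R => p.1.1).
Proof. by move=> p; apply: (cvg_comp _ _ cvg_fst); exact: cvg_fst. Qed.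

Let continuous_y : continuous (fun p : R * R * R => p.1.2).
Proof. by move=> p; apply: (cvg_comp _ _ cvg_fst); exact: cvg_snd. Qed.

Lemma continuous_rad : continuous rad.
Proof.
move=> p; apply: (cvg_comp _ Num.sqrt); last exact: sqrt_continuous.
by apply: cvgD; apply: cvgM; [exact: continuous_x|exact: continuous_x|
  exact: continuous_y|exact: continuous_y].
Qed.

Lemma continuous_radial t : continuous (radial t).
Proof.
move=> p; apply: cvgD; apply: cvgM; try exact: cvg_cst.
- exact: continuous_x.
- exact: continuous_y.
Qed.

Lemma continuous_tangential t : continuous (tangential t).
Proof.
move=> p; apply: cvgB; apply: cvgM; try exact: cvg_cst.
- exact: continuous_y.
- exact: continuous_x.
Qed.

Lemma cvg_polar (T : Type) (H : set_system T) {FH : Filter H} (a c : T -> R) t (a0 c0 : R) :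
  a @ H --> a0 -> c @ H --> c0 -> (fun x => polar (a x) t (c x)) @ H --> polar a0 t c0.
Proof.
move=> ha hc.
exact: (cvg_pair (cvg_pair (cvgM ha (cvg_cst (cos t))) (cvgM ha (cvg_cst (sin t)))) hc).
Qed.

Lemma cvg_rad_z p : (fun q : R * R * R => (rad q, q.2)) @ p --> (rad p, p.2).
Proof. exact: (cvg_pair (@continuous_rad p) cvg_snd). Qed.

Lemma near_radial t p : 0 < radial t p -> \forall q \near p, 0 < radial t q.
Proof. 
move=> tp; have := cvgr_gt _ (@continuous_radial t p) _ tp.
by move/(_ (nbhs_filter p)).
Qed.

Lemma continuous_angle t p : 0 < radial t p -> {for p, continuous (angle t)}.
Proof.
move=> a0; apply: cvgD; first exact: cvg_cst.
apply: (cvg_comp _ atan); last exact: continuous_atan.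
apply: cvgM; first exact: continuous_tangential.
by apply: cvgV; [rewrite gt_eqF | exact: continuous_radial].
Qed.

End Polar.

(* [J] stands for multiplication by i and [turn t] for multiplication by e^(it),
   so that [mode J rho] is [is_mode rho] without reference to complex scalars. *)
Section Mode.
Variables (R : realType) (W : normedModType R) (J : {linear W -> W}).
Hypotheses (JJ : forall x, J (J x) = - x) (normJ : forall x, `|J x| = `|x|).

Definition turn (t : R) (x : W) : W := cos t *: x + sin t *: J x.

Lemma turn0 x : turn 0 x = x.
Proof. by rewrite /turn cos0 sin0 scale1r scale0r addr0. Qed.

Lemma turn_pi x : turn pi x = - x.
Proof. by rewrite /turn cospi sinpi scaleN1r scale0r addr0. Qed.

Lemma turn_is_linear t : linear (turn t).
Proof.
move=> a x y; rewrite /turn linearP !scalerDr !scalerA !(mulrC _ a) addrACA.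
by [].
Qed.

HB.instance Definition _ t := GRing.isLinear.Build R W W _ (turn t) (turn_is_linear t).

Lemma turnD s t x : turn (s + t) x = turn s (turn t x).
Proof.
rewrite /turn cosD sinD (linearD J) !(linearZ_LR J) JJ !scalerDr !scalerA scalerN.
rewrite scalerBl scalerDl [X in _ + X]addrC addrACA; congr (_ + _).
by rewrite addrC.
Qed.

Lemma continuous_J : continuous J.
Proof.
move=> x; apply/cvgrPdist_lt => e e0.
near=> y; rewrite -linearB normJ; near: y.
exact: cvgr_dist_lt.
Unshelve. all: by end_near. Qed.

(** The factor 2 is the price of the abstraction: an isometry [J] of square -1 on a real normed
    space need not make [turn t] isometric. *)
Lemma norm_turn t x : `|turn t x| <= 2 * `|x|.
Proof.
rewrite mulrDl mul1r; apply: le_trans (ler_normD _ _) _.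
by rewrite !normrZ normJ; apply: lerD; rewrite ler_piMl // ?cos_max ?sin_max.
Qed.

Lemma continuous_turn t : continuous (turn t).
Proof.
move=> x; apply: cvgD; apply: cvgZl_tmp; [exact: cvg_id | exact: continuous_J].
Qed.

Lemma is_derive_turn (th : R -> R) (v : R -> W) (s th' : R) A :
  is_derive s (1 : R) th th' -> is_derive s (1 : R) v A ->
  is_derive s (1 : R) (fun s => turn (th s) (v s))
    (turn (th s) (A + th' *: J (v s))).
Proof.
move=> dth dv.
have dc : is_derive s (1 : R) (cos \o th) (th' *: - sin (th s)).
  exact: is_derive1_comp dth (is_derive_cos _).
have ds : is_derive s (1 : R) (sin \o th) (th' *: cos (th s)).
  exact: is_derive1_comp dth (is_derive_sin _).
have dJ := is_derive_linear continuous_J dv.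
have := is_deriveD (is_derive1_scale dc dv) (is_derive1_scale ds dJ).
move=> H; apply: is_derive_eq H _.
rewrite /turn (linearD J) (linearZ_LR J) JJ !scalerDr !scalerN !scalerA /=.
rewrite (addrC (- _ *: _)) addrACA -[th' *: cos _]/(th' * cos _) (mulrC th').
congr (_ + _); rewrite addrC -[th' *: sin _]/(th' * sin _) (mulrC th').
by rewrite scaleNr.
Qed.

Variables (rho : R).
Hypothesis rho0 : 0 < rho.
Local Notation U := (cylinder rho).
Local Notation S := (open_half_strip rho).
Implicit Types (k : int) (F G : R * R * R -> W) (f g : R * R -> W).

Lemma cylinderE p : U p <-> rad p < rho.
Proof.
have rE : Num.sqrt (rho ^+ 2) = rho by rewrite sqrtr_sqr gtr0_norm.
by rewrite /cylinder /rad /= -[X in _ <-> _ < X]rE ltr_sqrt // exprn_gt0.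
Qed.

Lemma open_cylinder : open U.
Proof.
rewrite (_ : U = @rad R @^-1` `]-oo, rho[%classic).
  by apply: open_comp; [move=> p _; exact: continuous_rad | exact: interval_open].
by apply/seteqP; split => p; rewrite /= in_itv /= => /cylinderE.
Qed.

Let oU := open_cylinder.

Lemma cylinder_polar r t z : 0 <= r < rho -> U (polar r t z).
Proof. by move=> /andP[r0 rr]; apply/cylinderE; rewrite rad_polar. Qed.

Lemma cylinder_polarP p : U p ->
  exists2 r, 0 <= r < rho & exists t, p = polar r t p.2.
Proof.
case: p => [[x y] z] /cylinderE; have [r r0 [t ->]] := polarP x y z.
by rewrite rad_polar // => rr; exists r; [rewrite r0 | exists t].
Qed.

Definition mode k F f : Prop :=
  (forall r t z, 0 <= r < rho -> F (polar r t z) = turn (k%:~R * t) (f (r, z))) /\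
  (k != 0 -> forall z, f (0, z) = 0).

(** * Continuity and derivatives of a mode in terms of its radial coefficient *)

Section ModeTheory.
Variables (k : int) (F : R * R * R -> W) (f : R * R -> W).
Hypothesis Ff : mode k F f.

Lemma mode_angle t p : U p -> 0 < radial t p ->
  F p = turn (k%:~R * angle t p) (f (rad p, p.2)).
Proof.
move=> /cylinderE Up tp; rewrite {1}(polar_angle tp); apply: Ff.1.
by rewrite sqrtr_ge0.
Qed.

Lemma mode_norm p : U p -> `|F p| <= 2 * `|f (rad p, p.2)|.
Proof.
move=> Up; have [r r0 [t pE]] := cylinder_polarP Up.
rewrite pE Ff.1 // rad_polar; first exact: norm_turn.
by case/andP: r0.
Qed.

Lemma mode0 p : k = 0 -> U p -> F p = f (rad p, p.2).
Proof.
move=> k0 Up; have [r r0 [t pE]] := cylinder_polarP Up.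
rewrite pE Ff.1 // rad_polar; last by case/andP: r0.
by rewrite k0 mul0r turn0.
Qed.

Lemma mode_polar0 r z : 0 <= r < rho -> F (polar r 0 z) = f (r, z).
Proof. by move=> rr; rewrite Ff.1 // mulr0 turn0. Qed.

(** Off the axis the local formula [mode_angle] is continuous. On the axis the angle has no limit,
    but for k = 0 it does not enter, and for k != 0 the coefficient tends to 0 while the rotation
    stays bounded. *)
Lemma mode_continuous : C0_rad rho k f -> forall p, U p -> {for p, continuous F}.
Proof.
move=> fC p Up; have [r rr [t pE]] := cylinder_polarP Up.
have [r0|r0] := eqVneq r 0; last first.
  have rp : 0 < r by rewrite lt_neqAle eq_sym r0; case/andP: rr.
  have tp : 0 < radial t p by rewrite pE radial_polar.
  have cv : {for p, continuous (fun q => f (rad q, q.2))}.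
    apply: (cvg_comp (fun q => (rad q, q.2)) f (G := nbhs (rad p, p.2))).
      exact: cvg_rad_z.
    apply: (C0_rad_continuous fC); rewrite /open_half_strip /= pE rad_polar ?ltW //.
    by rewrite rp; case/andP: rr.
  have ca : {for p, continuous (fun q => k%:~R * angle t q)}.
    by apply: cvgM; [exact: cvg_cst | exact: continuous_angle].
  have : {for p, continuous (fun q => turn (k%:~R * angle t q) (f (rad q, q.2)))}.
    apply: cvgD; apply: cvgZ => //.
    - exact: (cvg_comp _ _ ca (@continuous_cos _ _)).
    - exact: (cvg_comp _ _ ca (@continuous_sin _ _)).
    - exact: (cvg_comp _ _ cv (@continuous_J _)).
  rewrite /prop_for /continuous_at -mode_angle //.
  apply: cvg_trans; apply: near_eq_cvg; near=> q; rewrite -mode_angle //.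
  - by near: q; exact: (open_nbhs_nbhs (conj oU Up)).
  - by near: q; exact: near_radial tp.
have cv : f (rad q, q.2) @[q --> p] --> f (0, p.2).
  have H0 : half_strip rho (0, p.2) by rewrite /half_strip /= lexx.
  move=> A /((subspace_continuousP (half_strip rho) f).1 fC.1 _ H0) HA.
  have C : (fun q => (rad q, q.2)) @ p --> (0, p.2).
    rewrite -[X in _ --> (X, _)](_ : rad p = 0); first exact: cvg_rad_z.
    by rewrite pE rad_polar r0.
  rewrite /nbhs /=; near=> q; have : half_strip rho (rad q, q.2).
    rewrite /half_strip /= sqrtr_ge0 /=; apply/cylinderE.
    by near: q; exact: (open_nbhs_nbhs (conj oU Up)).
  by near: q; exact: (C _ HA).
have radp : rad p = 0 by rewrite pE rad_polar r0.
have [k0|k0] := eqVneq k 0.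
  rewrite /prop_for /continuous_at mode0 // radp; apply: cvg_trans cv.
  apply: near_eq_cvg; near=> q; rewrite mode0 //.
  by near: q; exact: (open_nbhs_nbhs (conj oU Up)).
have Fp : F p = 0.
  by apply/eqP; rewrite -normr_le0 (le_trans (mode_norm Up)) // radp Ff.2 // normr0 mulr0.
rewrite Ff.2 // in cv.
rewrite /prop_for /continuous_at Fp; apply/cvgr0Pnorm_le => e e0.
near=> q; apply: (le_trans (@mode_norm q _)).
  by near: q; exact: (open_nbhs_nbhs (conj oU Up)).
rewrite -ler_pdivlMl //; near: q.
by apply: cvgr0_norm_le cv _ _; rewrite mulr_gt0 ?invr_gt0.
Unshelve. all: by end_near. Qed.

Lemma is_derive_mode_z r t z A : 0 <= r < rho ->
  is_derive (r, z) ((0, 1) : R * R) f A ->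
  is_derive (polar r t z) ((0, 0, 1) : R * R * R) F (turn (k%:~R * t) A).
Proof.
move=> rr /is_derive_line0 df; apply/is_derive_line0.
have := is_derive_linear (L := turn (k%:~R * t)) (@continuous_turn _) df.
rewrite (_ : _ \o _ = fun s => F (polar r t z + s *: ((0, 0, 1) : R * R * R))) //.
apply/funext => s /=.
rewrite (_ : polar r t z + _ = polar r t (z + s)); last first.
  by rewrite /polar; congr (_, _, _); rewrite /= ?scaler0 ?addr0 // -[_ *: 1]/(_ * 1) mulr1.
rewrite Ff.1 //; congr (turn _ (f _)).
by congr (_, _); rewrite /= ?scaler0 ?addr0 // -[_ *: 1]/(_ * 1) mulr1.
Qed.

(** Along the line the coordinates in the frame rotated by t are exactly r + s * [al] and s * [be],
    so at s = 0 the radius has derivative [al] and the angle [be] / r. *)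
Lemma is_derive_mode_xy r t z (e1 e2 : R) A : 0 < r < rho ->
  is_derive (r, z) ((1, 0) : R * R) f A ->
  is_derive (polar r t z) ((e1, e2, 0) : R * R * R) F
    (turn (k%:~R * t) ((e1 * cos t + e2 * sin t) *: A +
       (k%:~R * ((e2 * cos t - e1 * sin t) / r)) *: J (f (r, z)))).
Proof.
move=> /andP[r0 rr] df; apply/is_derive_line0.
set al := e1 * _ + _; set be := e2 * _ - _.
set p := polar r t z; set e : R * R * R := (e1, e2, 0).
pose q (s : R) : R * R * R := p + s *: e.
have q0 : q 0 = p by rewrite /q scale0r addr0.
have radq s : radial t (q s) = r + s * al.
  rewrite /radial /= -!/(_ * _); have := cos2sin2 t => cs.
  rewrite -[s *: e1]/(s * e1) -[s *: e2]/(s * e2) /al; ring: cs.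
have tanq s : tangential t (q s) = s * be.
  rewrite /tangential /=.
  rewrite -[s *: e1]/(s * e1) -[s *: e2]/(s * e2) /be; ring.
have dlin (a b : R) : is_derive (0 : R) (1 : R) (fun s : R => a + s * b) b.
  have dm : is_derive (0 : R) (1 : R) ( *%R^~ b) b.
    by apply: is_derive_eq; rewrite scaler0 add0r -[b%:A]/(b * 1) mulr1.
  by have := is_deriveD (is_derive_cst a (0 : R) 1) dm; rewrite add0r.
have drad : is_derive (0 : R) (1 : R) (@rad R \o q) al.
  have dx := dlin p.1.1 e1; have dy := dlin p.1.2 e2.
  have dN : is_derive (0 : R) (1 : R) (fun s => (q s).1.1 ^+ 2 + (q s).1.2 ^+ 2)
      (2 * r * al).
    apply: is_derive_eq (is_deriveD (is_deriveM dx dx) (is_deriveM dy dy)) _.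
    rewrite -![_ *: _]/(_ * _) /al /p /polar /=; ring.
  have N0 : (q 0).1.1 ^+ 2 + (q 0).1.2 ^+ 2 = r ^+ 2.
    by rewrite q0 /= !exprMn -mulrDr cos2Dsin2 mulr1.
  have N1 : 0 < (q 0).1.1 ^+ 2 + (q 0).1.2 ^+ 2 by rewrite N0 exprn_gt0.
  apply: is_derive_eq (is_derive1_comp dN (is_derive1_sqrt N1)) _.
  rewrite N0 sqrtr_sqr gtr0_norm // -[_ *: _]/(_ * _).
  by field; rewrite gt_eqF.
have dang : is_derive (0 : R) (1 : R) (fun s => k%:~R * angle t (q s)) (k%:~R * (be / r)).
  rewrite (_ : (fun s => _) = k%:~R \*: (cst t +
      (@atan R \o (fun s : R => (0 + s * be) / (r + s * al))))); last first.
    by apply/funext => s; rewrite /angle tanq radq /= [X in _ = _ * (t + atan (X / _))]add0r.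
  apply: is_deriveZ; rewrite -[be / r]add0r; apply: is_deriveD.
  have r1 : r + 0 * al != 0 by rewrite mul0r addr0 gt_eqF.
  have := is_deriveM (dlin 0 be) (@is_deriveV _ (fun s => r + s * al) 0 al 1 r1 (dlin r al)).
  move=> /is_derive1_comp/(_ (is_derive1_atan _)) H; apply: is_derive_eq H _.
  rewrite [X in 1 + X ^+ 2](_ : _ = 0); last first.
    by rewrite -[LHS]/((0 + 0 * be) * (r + 0 * al)^-1) !mul0r addr0 mul0r.
  rewrite -![_ *: _]/(_ * _) !mul0r !addr0 !mul0r !add0r expr0n /= addr0 invr1 mulr1.
  by rewrite mulrC.
have dfr : is_derive ((@rad R \o q) 0) (1 : R) (fun x => f (x, z)) A.
  rewrite /= q0 rad_polar ?ltW //.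
  have := (is_derive_line f ((0, z) : R * R) (1, 0) r A).1.
  have rE (x : R) : ((0, z) : R * R) + x *: ((1, 0) : R * R) = (x, z).
    by congr (_, _); rewrite /= ?add0r -[_ *: _]/(_ * _) ?mulr1 // mulr0 addr0.
  by rewrite rE => /(_ df); under eq_fun do rewrite rE.
have := is_derive_turn dang (is_derive1_comp drad dfr).
rewrite /= q0 angle_polar rad_polar ?ltW //.
apply: near_eq_is_derive.
have : \forall x \near p, F x = turn (k%:~R * angle t x) (f (rad x, x.2)).
  near=> x; apply: mode_angle; near: x.
    apply: (open_nbhs_nbhs (conj oU _)); apply: cylinder_polar.
    by rewrite ltW.
  by apply: near_radial; rewrite radial_polar.
move=> /(near_line e); apply: filterS => s ->.
by rewrite /= -[_ *: 0]/(_ * 0) mulr0 addr0.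
Unshelve. all: by end_near. Qed.

(** On the half plane of angle 0 the mode F coincides with f, so x- and z-derivatives of F there are
    r- and z-derivatives of f. *)
Lemma is_derive_mode_profile p (e : R * R) A : S p ->
  is_derive (polar p.1 0 p.2) ((e.1, 0, e.2) : R * R * R) F A -> is_derive p e f A.
Proof.
move=> Sp /is_derive_line0 dF; apply/is_derive_line0.
apply: near_eq_is_derive dF.
have : \forall q \near p, S q by exact: (open_nbhs_nbhs (conj (@open_half_strip_open R rho) Sp)).
move=> /(near_line e); apply: filterS => s /andP[s1 s2].
rewrite (_ : polar _ _ _ + _ = polar (p + s *: e).1 0 (p + s *: e).2); last first.
  rewrite /polar sin0 cos0; congr (_, _, _); rewrite /= !(mulr0, mulr1) //.
  by rewrite -[s *: 0]/(s * 0) mulr0 addr0.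
rewrite mode_polar0; last by rewrite ltW.
by case: (p + s *: e).
Qed.

Lemma mode_C0_rad : (forall p, U p -> {for p, continuous F}) -> C0_rad rho k f.
Proof.
move=> cF; split=> [|z]; last first.
  have [->|k0] := eqVneq k 0; first by rewrite scale0r.
  by rewrite Ff.2 // scaler0.
apply/subspace_continuousP => q Hq.
have Uq : U (polar q.1 0 q.2) by exact: cylinder_polar.
suff : f @ within (half_strip rho) (nbhs q) --> f q by [].
have -> : f q = F (polar q.1 0 q.2) by rewrite mode_polar0 //; case: q {Hq Uq}.
have cP : (fun x : R * R => polar x.1 0 x.2) @ q --> polar q.1 0 q.2.
  have c1 : continuous (@fst R R) by move=> x; exact: cvg_fst.
  have c2 : continuous (@snd R R) by move=> x; exact: cvg_snd.
  exact: (cvg_polar (t := 0) (c1 q) (c2 q)).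
have := cvg_comp _ _ cP (cF _ Uq) => C.
have C' : (F \o (fun x => polar x.1 0 x.2)) @ within (half_strip rho) (nbhs q) -->
    F (polar q.1 0 q.2).
  by apply: cvg_within_filter; exact: C.
apply: cvg_trans C'; apply: near_eq_cvg; rewrite near_withinE; near=> x => Hx.
by rewrite /= mode_polar0 //; case: (x).
Unshelve. all: by end_near. Qed.

End ModeTheory.

(** On the axis, approaching along angle t shows that the value is fixed by every rotation
    [turn (k%:~R * t)]. *)
Lemma mode_of_continuous k G g :
  (forall p, U p -> {for p, continuous G}) ->
  (forall r t z, 0 < r < rho -> G (polar r t z) = turn (k%:~R * t) (g (r, z))) ->
  (forall z, g (0, z) = G (polar 0 0 z)) ->
  mode k G g.
Proof.
move=> cG Gg g0.
have pol0 (t z : R) : polar 0 t z = polar 0 0 z by rewrite /polar !mul0r.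
have lim t z : G (polar r t z) @[r --> (0:R)^'+] --> G (polar 0 0 z).
  rewrite -(pol0 t); apply: cvg_at_right_filter.
  apply: (cvg_comp (fun r : R => polar r t z) G); last first.
    by apply: cG; apply: cylinder_polar; rewrite lexx rho0.
  exact: (cvg_polar (H := nbhs (0 : R)) (a := id) (c := cst z) cvg_id (cvg_cst z)).
have G0 t z : G (polar 0 0 z) = turn (k%:~R * t) (G (polar 0 0 z)).
  have L1 := lim t z.
  have L2 : turn (k%:~R * t) (G (polar r 0 z)) @[r --> (0:R)^'+] -->
      turn (k%:~R * t) (G (polar 0 0 z)).
    exact: (cvg_comp _ _ (lim 0 z) (@continuous_turn _ _)).
  suff L3 : G (polar r t z) @[r --> (0:R)^'+] --> turn (k%:~R * t) (G (polar 0 0 z)).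
    exact: (cvg_unique _ L1 L3).
  apply: cvg_trans L2; apply: near_eq_cvg; near=> r.
  have rr : 0 < r < rho.
    by apply/andP; split; near: r; [exact: nbhs_right_gt | exact: nbhs_right_lt].
  by rewrite !Gg // mulr0 turn0.
split=> [r t z /andP[]|k0 z].
  rewrite le_eqVlt => /predU1P[<- _|r0 rr]; last by rewrite Gg // r0.
  by rewrite pol0 g0 -G0.
have kR0 : k%:~R != 0 :> R by rewrite intr_eq0.
(* At this angle the rotation is -1, so the axis value equals its negative and vanishes. *)
have := G0 (pi / k%:~R) z; rewrite mulrCA divff // mulr1 turn_pi -g0 => /eqP.
by rewrite -addr_eq0 -mulr2n -scaler_nat scaler_eq0 pnatr_eq0 /= => /eqP.
Unshelve. all: by end_near. Qed.

(** In polar coordinates D_x - i D_y = e^(-it) (D_r - (i/r) D_t), and D_t acts on the mode as ik;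
    the conjugate formula gives the other half. *)
Lemma mode_wirtinger k F f q t A : mode k F f -> S q ->
  is_derive q ((1, 0) : R * R) f A ->
  let Dx := 'D_(1, 0, 0) F (polar q.1 t q.2) in
  let Dy := 'D_(0, 1, 0) F (polar q.1 t q.2) in
  Dx - J Dy = turn ((k - 1)%:~R * t) (radD k f q) /\
  Dx + J Dy = turn ((k + 1)%:~R * t) (radD (- k) f q).
Proof.
case: q => r z Ff rr df Dx Dy.
have fA : partial_r f (r, z) = A by exact: is_derive_derive df.
have -> : Dx = turn (k%:~R * t) (cos t *: A - (k%:~R / r * sin t) *: J (f (r, z))).
  apply: is_derive_derive; apply: is_derive_eq (is_derive_mode_xy Ff t 1 0 rr df) _.
  by rewrite !mul1r !mul0r addr0 sub0r -scaleNr; congr (turn _ (_ + _ *: _)); ring.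
have -> : Dy = turn (k%:~R * t) (sin t *: A + (k%:~R / r * cos t) *: J (f (r, z))).
  apply: is_derive_derive; apply: is_derive_eq (is_derive_mode_xy Ff t 0 1 rr df) _.
  by rewrite !mul1r !mul0r add0r subr0; congr (turn _ (_ + _ *: _)); ring.
have Jturn s x : J (turn s x) = turn s (J x) by rewrite /turn linearD !(linearZ_LR J).
rewrite Jturn -linearB -linearD /= /radD fA !rmorphD !rmorphN /= !mulrDl mulN1r mul1r !turnD.
set al := k%:~R / r; split; congr turn.
- rewrite /turn cosN sinN !(linearD J) !(linearZ_LR J) JJ scalerN !scalerDr !scalerA.
  rewrite opprB mulNr !scaleNr (mulrC (cos t)) (mulrC (sin t)) -!addrA; congr (_ + _).
  by rewrite [LHS]addrCA; congr (_ + _); exact: addrC.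
- rewrite /turn !(linearD J) !(linearZ_LR J) JJ mulNr !scalerDr !scalerN !scalerA.
  rewrite !mulrN !scaleNr (mulrC (cos t)) (mulrC (sin t)) -!addrA; congr (_ + _).
  by rewrite [LHS]addrCA [RHS]addrCA; congr (_ + _); exact: addrC.
Qed.

Lemma Cm_rad_of_Cm m k F f : mode k F f -> is_Cm m U F -> Cm_rad rho m k f.
Proof.
elim: m k F f => [|m IH] k F f Ff CF.
  by apply: Cm_rad0; apply: (mode_C0_rad Ff) => p; exact: is_Cm_continuous CF.
have fC : C0_rad rho k f.
  by apply: (mode_C0_rad Ff) => p; exact: is_Cm_continuous CF.
have [dx Cx] := is_Cm_derive CF (Or31 _ _ erefl).
have [dy Cy] := is_Cm_derive CF (Or32 _ _ erefl).
have [dz Cz] := is_Cm_derive CF (Or33 _ _ erefl).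
have SU q : S q -> U (polar q.1 0 q.2).
  by move=> /andP[q0 q1]; apply: cylinder_polar; rewrite ltW.
have fr q : S q -> is_derive q ((1, 0) : R * R) f ('D_(1, 0, 0) F (polar q.1 0 q.2)).
  by move=> Sq; apply: (is_derive_mode_profile Ff Sq); exact/derivableP/dx/SU.
have fz q : S q -> is_derive q ((0, 1) : R * R) f ('D_(0, 0, 1) F (polar q.1 0 q.2)).
  by move=> Sq; apply: (is_derive_mode_profile Ff Sq); exact/derivableP/dz/SU.
pose G1 : R * R * R -> W := 'D_(1, 0, 0) F \- (J \o 'D_(0, 1, 0) F).
pose G2 : R * R * R -> W := 'D_(1, 0, 0) F \+ (J \o 'D_(0, 1, 0) F).
pose G3 : R * R * R -> W := 'D_(0, 0, 1) F.
have CJ := is_Cm_linear oU continuous_J Cy.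
have C1 : is_Cm m U G1 by exact: (is_CmB oU Cx CJ).
have C2 : is_Cm m U G2 by exact: (is_CmD oU Cx CJ).
(* The profile at angle 0 takes the values of G on the axis, so continuity of G makes it the
   required extension. *)
pose prof (G : R * R * R -> W) (q : R * R) := G (polar q.1 0 q.2).
have E1 : eq_strip rho (prof G1) (radD k f).
  move=> q Sq; have := (mode_wirtinger 0 Ff Sq (fr q Sq)).1.
  by rewrite mulr0 turn0.
have E2 : eq_strip rho (prof G2) (radD (- k) f).
  move=> q Sq; have := (mode_wirtinger 0 Ff Sq (fr q Sq)).2.
  by rewrite mulr0 turn0.
have E3 : eq_strip rho (prof G3) (partial_z f).
  by move=> q Sq; rewrite /prof /G3 -(is_derive_derive (fz q Sq)).
have M1 : mode (k - 1) G1 (prof G1).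
  apply: mode_of_continuous => // [p|r t z rr]; first exact: is_Cm_continuous C1.
  rewrite (E1 (r, z)) //.
  have Sq : S (r, z) by [].
  by have [] := mode_wirtinger t Ff Sq (fr _ Sq).
have M2 : mode (k + 1) G2 (prof G2).
  apply: mode_of_continuous => // [p|r t z rr]; first exact: is_Cm_continuous C2.
  rewrite (E2 (r, z)) //.
  have Sq : S (r, z) by [].
  by have [] := mode_wirtinger t Ff Sq (fr _ Sq).
have M3 : mode k G3 (prof G3).
  apply: mode_of_continuous => // [p|r t z rr]; first exact: is_Cm_continuous Cz.
  have rr' : 0 <= r < rho by case/andP: rr => r0 ->; rewrite ltW.
  rewrite E3 // /partial_z (is_derive_derive (fz (r, z) rr)).
  by apply: is_derive_derive; apply: (is_derive_mode_z Ff t rr'); exact: fz.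
apply: (Cm_radS fC _ _ E1 (IH _ _ _ M1 C1) E2 (IH _ _ _ M2 C2) E3 (IH _ _ _ M3 Cz)).
- by move=> q Sq; exact: is_derive_derivable (fr q Sq).
- by move=> q Sq; exact: is_derive_derivable (fz q Sq).
Qed.

Lemma Cm_of_Cm_rad m k F f : mode k F f -> Cm_rad rho m k f -> is_Cm m U F.
Proof.
elim: m k F f => [|m IH] k F f Ff fC.
  by split=> //; exact: (mode_continuous Ff fC.1).
have cF := mode_continuous Ff fC.1.
have [fr [g1 g1C g1E]] := Cm_radS_lower fC.
have [g2 g2C g2E] := Cm_radS_raise fC.
have [fz [g3 g3C g3E]] := Cm_radS_z fC.
(* [p.1] is the pair (x, y), so [p.1 != 0] says that p lies off the axis. *)
have axis (p : R * R * R) : U p -> p.1 != 0 -> exists2 q, S q & exists t, p = polar q.1 t q.2.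
  move=> Up p0; have [r rr [t pE]] := cylinder_polarP Up.
  exists (r, p.2); last by exists t.
  rewrite /open_half_strip /= lt_neqAle; case/andP: rr => -> ->; rewrite !andbT.
  by apply: contra_neq p0 => r0; rewrite pE /polar -r0 /= !mul0r.
have polar_axis (q : R * R) t : S q -> (polar q.1 t q.2).1 != 0.
  move=> /andP[q0 _]; apply/eqP => -[/eqP + /eqP].
  rewrite !mulf_eq0 gt_eqF //= => /eqP c0 /eqP s0.
  by have := cos2Dsin2 t; rewrite c0 s0 expr0n addr0 => /eqP; rewrite eq_sym oner_eq0.
pose Dx := 'D_(1, 0, 0) F; pose Dy := 'D_(0, 1, 0) F; pose Dz := 'D_(0, 0, 1) F.
(* [D] will be a derivative of [F], a junk value on the axis as long as [F] is not
   known to be differentiable there; it is replaced by the extended coefficient. *)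
pose ext (D : R * R * R -> W) (g : R * R -> W) (p : R * R * R) :=
  if p.1 == 0 then g (0, p.2) else D p.
have ext_mode j D g : C0_rad rho j g ->
    (forall q t, S q -> D (polar q.1 t q.2) = turn (j%:~R * t) (g q)) ->
    mode j (ext D g) g.
  move=> gC Dg; have g0 : j != 0 -> forall z, g (0, z) = 0.
    move=> j0 z; apply/eqP; have /eqP := gC.2 z.
    by rewrite scaler_eq0 intr_eq0 (negbTE j0).
  split=> // r t z /andP[]; rewrite le_eqVlt => /predU1P[<- _|r0 rr].
    rewrite /ext /polar !mul0r eqxx /=.
    by have [->|/g0 ->] := eqVneq j 0; rewrite ?mul0r ?turn0 ?linear0.
  have Srz : S (r, z) by rewrite /open_half_strip /= r0.
  by rewrite /ext (negbTE (polar_axis (r, z) t Srz)) (Dg (r, z)).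
pose G1 := ext (Dx \- (J \o Dy)) g1.
pose G2 := ext (Dx \+ (J \o Dy)) g2.
pose G3 := ext Dz g3.
have M1 : mode (k - 1) G1 g1.
  apply: ext_mode => // q t Sq; rewrite g1E //.
  exact: (mode_wirtinger t Ff Sq (derivableP (fr q Sq))).1.
have M2 : mode (k + 1) G2 g2.
  apply: ext_mode => // q t Sq; rewrite g2E //.
  exact: (mode_wirtinger t Ff Sq (derivableP (fr q Sq))).2.
have M3 : mode k G3 g3.
  apply: ext_mode => // -[r z] t Sq; rewrite g3E //.
  apply: is_derive_derive; apply: (is_derive_mode_z Ff); last exact/derivableP/fz.
  by case/andP: Sq => /= r0 ->; rewrite ltW.
have C1 : is_Cm m U G1.
  by apply: (IH _ _ _ M1); apply: (Cm_rad_lower fC g1C) => q Sq; rewrite g1E.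
have C2 : is_Cm m U G2.
  by apply: (IH _ _ _ M2); apply: (Cm_rad_raise fC g2C) => q Sq; rewrite g2E.
have C3 : is_Cm m U G3.
  by apply: (IH _ _ _ M3); apply: (Cm_rad_partial_z fC g3C) => q Sq; rewrite g3E.
have cs : continuous ( *:%R (2^-1 : R) : W -> W) by exact: scaler_continuous.
(* Off the axis G1 = D_x F - J D_y F and G2 = D_x F + J D_y F; these are solved for both
   derivatives, with J^2 = -1 for the second. *)
pose Gx := *:%R (2^-1 : R) \o (G1 \+ G2).
pose Gy := *:%R (2^-1 : R) \o (J \o (G1 \- G2)).
have Cx : is_Cm m U Gx by apply: is_Cm_linear => //; exact: is_CmD.
have Cy : is_Cm m U Gy.
  by apply: is_Cm_linear => //; apply: is_Cm_linear => //; [exact: continuous_J | exact: is_CmB].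
have off (e1 e2 : R) (p : R * R * R) : U p -> p.1 != 0 ->
    is_derive p ((e1, e2, 0) : R * R * R) F ('D_(e1, e2, 0) F p).
  move=> Up p0; have [q Sq [t ->]] := axis p Up p0.
  case: q Sq => r z Sq; apply/derivableP.
  exact: is_derive_derivable (is_derive_mode_xy Ff t e1 e2 Sq (derivableP (fr (r, z) Sq))).
have half (x : W) : 2^-1 *: (x + x) = x.
  have h2 : 2^-1 + 2^-1 = 1 :> R by field.
  by rewrite scalerDr -scalerDl h2 scale1r.
have offx p : U p -> p.1 != 0 -> is_derive p ((1, 0, 0) : R * R * R) F (Gx p).
  move=> Up p0; rewrite /Gx /= /G1 /G2 /ext (negbTE p0) /= addrACA addNr addr0 half.
  exact: off.
have offy p : U p -> p.1 != 0 -> is_derive p ((0, 1, 0) : R * R * R) F (Gy p).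
  move=> Up p0; rewrite /Gy /= /G1 /G2 /ext (negbTE p0) /=.
  rewrite opprD addrACA subrr add0r -opprD linearN linearD JJ -opprD opprK half.
  exact: off.
have offz p : U p -> p.1 != 0 -> is_derive p ((0, 0, 1) : R * R * R) F (G3 p).
  move=> Up p0; have [[r z] Sq [t ->]] := axis p Up p0.
  rewrite /G3 /ext (negbTE (polar_axis _ t Sq)); apply/derivableP.
  apply: is_derive_derivable; apply: (is_derive_mode_z Ff); last exact/derivableP/fz.
  by case/andP: Sq => /= r0 ->; rewrite ltW.
(* The vector w is horizontal and transversal to e, so that for s > 0 the whole line shifted by s *
   w avoids the axis. *)
have full (e w : R * R * R) G : is_Cm m U G ->
    (forall p : R * R * R, U p -> p.1 != 0 -> is_derive p e F (G p)) ->
    (forall (s t z : R), 0 < s -> (((0, 0, z) : R * R * R) + t *: e + s *: w).1 != 0) ->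
    forall p, U p -> is_derive p e F (G p).
  move=> CG offG ew p Up; have [p0|p0] := eqVneq p.1 0; last exact: offG.
  have -> : p = (0, 0, p.2) by case: p p0 {Up} => [xy z] /= ->.
  have U0 : U (0, 0, p.2).
    by have := @cylinder_polar 0 0 p.2; rewrite /polar !mul0r lexx rho0; exact.
  apply: (is_derive_extend (w := w)).
  - by apply: (near_open oU U0) => q; exact: cF.
  - exact: is_Cm_continuous CG U0.
  - have [d d0 H] := near_plane w e (open_nbhs_nbhs (conj oU U0)).
    exists d => // s t /andP[s0 sd] td; apply: offG; last exact: ew.
    by apply: H => //; rewrite gtr0_norm.
apply: is_CmS => // e [] ->.
- exists Gx => //; apply: (@full _ (0, 1, 0)) => // s t z s0.
  apply/eqP => -[_ /eqP]; rewrite /= -[t *: 0]/(t * 0) -[s *: 1]/(s * 1) mulr0 mulr1.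
  by rewrite !add0r gt_eqF.
- exists Gy => //; apply: (@full _ (1, 0, 0)) => // s t z s0.
  apply/eqP => -[/eqP + _]; rewrite /= -[t *: 0]/(t * 0) -[s *: 1]/(s * 1) mulr0 mulr1.
  by rewrite !add0r gt_eqF.
- exists G3 => //; apply: (@full _ (1, 0, 0)) => // s t z s0.
  apply/eqP => -[/eqP + _]; rewrite /= -[t *: 0]/(t * 0) -[s *: 1]/(s * 1) mulr0 mulr1.
  by rewrite !add0r gt_eqF.
Qed.

End Mode.

(** * Complex Banach spaces: [J] becomes multiplication by i *)

Section Complexified.
Variables (R : realType) (X : normedModType R[i]).
Local Notation W := (realified X).

Definition mul_i (x : W) : W := (0 +i* 1)%C *: (x : X).

Lemma mul_i_is_linear : linear mul_i.
Proof.
move=> a x y; rewrite /mul_i -[a *: x]/(a%:C%C *: (x : X)).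
by rewrite -[a *: _ in RHS]/(a%:C%C *: (_ : X)) scalerDr !scalerA mulrC.
Qed.

HB.instance Definition _ := GRing.isLinear.Build R W W _ mul_i mul_i_is_linear.

Lemma mul_iK (x : W) : mul_i (mul_i x) = - x.
Proof. by rewrite /mul_i scalerA -expr2 sqr_i scaleN1r. Qed.

Lemma norm_mul_i (x : W) : `|mul_i x| = `|x|.
Proof.
rewrite -[LHS]/(complex.Re `|(0 +i* 1)%C *: (x : X)|) normrZ normc_def /=.
by rewrite expr0n expr1n add0r sqrtr1 mul1r.
Qed.

Lemma turn_mul_i t (x : W) : turn mul_i t x = cis t *: (x : X).
Proof.
have -> : cis t = (cos t)%:C%C + (sin t)%:C%C * (0 +i* 1)%C.
  by apply/eqP; rewrite eq_complex /= !(mul0r, mulr0, mulr1, subr0, addr0, add0r) !eqxx.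
by rewrite scalerDl -scalerA.
Qed.

Lemma is_modeE rho k (F : R * R * R -> X) (f : R * R -> X) :
  is_mode rho k F f <-> mode mul_i rho k (F : _ -> W) (f : _ -> W).
Proof.
by split=> -[H1 H2]; split=> // r t z rr; have := H1 r t z rr; rewrite turn_mul_i.
Qed.

End Complexified.

Unset Implicit Arguments.

Theorem corollary3p2 (R : realType) (X : completeNormedModType R[i])
    (rho : R) (k : int) (m : nat)
    (fhat : R * R * R -> X) (f : R * R -> X) :
  0 < rho ->
  is_mode rho k fhat f ->
  is_Cm (W := realified X) m (cylinder rho) fhat <->
  Cm_rad (W := realified X) rho m k f.
Proof.
move=> rho0 /is_modeE Ff; split.
- exact: (Cm_rad_of_Cm (@mul_iK R X) (@norm_mul_i R X) rho0 Ff).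
- exact: (Cm_of_Cm_rad (@mul_iK R X) (@norm_mul_i R X) rho0 Ff).
Qed.
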